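(* Let $n\ge1$, $Q=n+2\ge3$ and $2\le p<Q$. Then for every $u\in C_0^\infty(B_1^Q(o)\setminus\{o\})$, $$\int_{B_1^Q(o)}\frac{|\mathcal{L}_{\varrho,G}u(x,t)|^p}{|\nabla_G\varrho(x,t)|^p\varrho^{Q-2p}(x,t)}\,dx\,dt-\left(\frac{(Q-2)(p-1)}{p}\right)^p\int_{B_1^Q(o)}\frac{|u(x,t)|^p|\nabla_G\varrho(x,t)|^p}{\varrho^Q(x,t)\big(\ln\frac1{\varrho(x,t)}\big)^p}\,dx\,dt\ \ge\ c_p\left(\frac{(Q-2)(p-1)}{p}\right)^p\sup_{R>0}d_C(u,R)^p,$$ where $c_p=\min_{0<\tau<1/2}\big[(1-\tau)^p-\tau^p+p\tau^{p-1}\big]$ and $$d_C(u,R)=\left(\int_{B_1^Q(o)}\frac{\Big|u(x,t)-\big(\ln\frac1{\varrho(x,t)}\big)^{\frac{p-1}{p}}R^{\frac{p-1}{p}}\,u\big(e^{-\frac1R}\tfrac{x}{\varrho(x,t)},e^{-\frac2R}\tfrac{t}{\varrho^2(x,t)}\big)\Big|^p}{\varrho^Q(x,t)\big(\ln\frac1{\varrho(x,t)}\big)^p\,\big|\ln\big(R\ln\frac1{\varrho(x,t)}\big)\big|^p}\,|\nabla_G\varrho(x,t)|^p\,dx\,dt\right)^{1/p}.$$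
   Context: Grushin space $G=\mathbb{R}^{n+1}$: points $(x,t)$ with $x\in\mathbb{R}^n$, $t\in\mathbb{R}$; origin $o=(\vec 0,0)$; homogeneous dimension $Q=n+2$; homogeneous norm $\varrho(x,t)=(|x|^4+4t^2)^{1/4}$; gauge ball $B_R^Q(o)=\{(x,t):\varrho(x,t)<R\}$; Grushin gradient $\nabla_G=(\nabla_x,|x|\partial_t)$, so that $|\nabla_G\varrho|^2=|x|^2/\varrho^2=:\psi$ away from $o$. Polar coordinates $(\varrho,\phi,w)$: $x=\varrho\sin^{1/2}\!\phi\;w$, $w\in\mathbb{S}^{n-1}$, $t=\frac{\varrho^2}{2}\cos\phi$, $0<\phi<\pi$. $\partial_\varrho$ is the partial derivative in $\varrho$ in these coordinates, i.e. $\partial_\varrho u=\frac1\varrho(x\cdot\nabla_xu+2t\,\partial_tu)$. Radial Grushin operator: $\mathcal{L}_{\varrho,G}u=\psi\big(\partial_\varrho^2u+\frac{Q-1}{\varrho}\partial_\varrho u\big)$. $C_0^\infty$ denotes smooth compactly supported real-valued functions. *)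

(* Defs.v *)
From HB Require Import structures.
From mathcomp Require Import all_boot all_order all_algebra.
From mathcomp Require Import all_classical all_reals all_analysis.

Set Implicit Arguments.
Unset Strict Implicit.
Unset Printing Implicit Defensive.

Import Order.TTheory GRing.Theory Num.Theory.
Import numFieldNormedType.Exports.

Local Open Scope classical_set_scope.
Local Open Scope ring_scope.

(* 'rV[R]_n carries the sigma-algebra generated by the coordinate maps, i.e.
   the Borel sigma-algebra. *)

Definition rV_display : measure_display.
Proof. exact: default_measure_display. Qed.

Definition rV_coord (R : realType) (n : nat) (i : 'I_n) (x : 'rV[R]_n) :
  measurableTypeR R := x ord0 i.

HB.instance Definition _ (R : realType) (n : nat) :=
  @isMeasurable.Build rV_display 'rV[R]_n (g_sigma_preimage (@rV_coord R n))
    (@sigma_algebra0 _ _ _) (@sigma_algebraC _ _)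
    (@sigma_algebra_bigcup _ setT _).

Definition rV_snoc (R : realType) (n : nat)
    (z : 'rV[R]_n * measurableTypeR R) : 'rV[R]_n.+1 :=
  \row_(i < n.+1) oapp (z.1 ord0) (z.2 : R) (unlift ord_max i).

Lemma measurable_rV_coord (R : realType) (n : nat) (i : 'I_n) :
  measurable_fun [set: 'rV[R]_n] (rV_coord i).
Proof.
move=> _ Y mY; rewrite setTI; apply: sub_sigma_algebra => /=.
rewrite -bigcup_seq/=; exists i => /=; first by rewrite mem_index_enum.
by exists Y => //; rewrite setTI.
Qed.

Lemma measurable_fun_rV d (T : measurableType d) (R : realType) (n : nat)
    (f : T -> 'rV[R]_n) :
  (forall i, measurable_fun [set: T] (fun x => rV_coord i (f x))) ->
  measurable_fun [set: T] f.
Proof.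
move=> mf _ Y mY; rewrite setTI.
suff /(_ Y mY) : measurable `<=` [set A : set 'rV[R]_n | measurable (f @^-1` A)].
  by [].
apply: smallest_sub.
  split => [|A /= mA|F mF] /=; first by rewrite preimage_set0.
    by rewrite setTD preimage_setC; apply: measurableC.
  rewrite preimage_bigcup; by apply: bigcupT_measurable => k; exact: mF.
rewrite -bigcup_seq => A [i _ [B mB <-]] /=; rewrite setTI.
by rewrite -[X in measurable X]setTI; exact: mf.
Qed.

Lemma measurable_rV_snoc (R : realType) (n : nat) :
  measurable_fun [set: 'rV[R]_n * measurableTypeR R] (@rV_snoc R n).
Proof.
apply: measurable_fun_rV => i; rewrite /rV_snoc /rV_coord.
under eq_fun do rewrite mxE.
case: (unlift ord_max i) => [j|] /=; last exact: measurable_snd.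
exact: (measurableT_comp (measurable_rV_coord j) measurable_fst).
Qed.

Definition lebesgue_rV_step (R : realType) (n : nat)
    (m : {measure set 'rV[R]_n -> \bar R}) : set 'rV[R]_n.+1 -> \bar R :=
  pushforward (m \x @lebesgue_measure R)%E (@rV_snoc R n).

HB.instance Definition _ (R : realType) (n : nat)
    (m : {measure set 'rV[R]_n -> \bar R}) :=
  Measure.copy (lebesgue_rV_step m)
    (measure_function_pushforward__canonical__measure_function_Measure
       (m \x @lebesgue_measure R)%E (@measurable_rV_snoc R n)).

Fixpoint lebesgue_rV (R : realType) (n : nat) :
    {measure set 'rV[R]_n -> \bar R} :=
  match n with
  | 0 => \d_(0 : 'rV[R]_0)
  | n'.+1 => lebesgue_rV_step (lebesgue_rV R n')
  end.

Lemma lebesgue_rV_box (R : realType) (n : nat) (A : 'I_n -> set R) :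
  (forall i, measurable (A i : set (measurableTypeR R))) ->
  lebesgue_rV R n [set x | forall i, A i (x ord0 i)] =
  (\prod_(i < n) @lebesgue_measure R (A i))%E.
Proof.
elim: n A => [|n IHn] A mA.
  by rewrite big_ord0 /= diracE mem_set// => -[].
rewrite /= /lebesgue_rV_step /pushforward.
rewrite (_ : _ @^-1` _ = [set x : 'rV[R]_n | forall i, A (lift ord_max i) (x ord0 i)]
    `*` A ord_max); last first.
  apply/seteqP; split => [z Az|z [/= Az1 Az2] i].
    split => [i|] /=.
      by have := Az (lift ord_max i); rewrite /rV_snoc mxE liftK.
    by have := Az ord_max; rewrite /rV_snoc mxE unlift_none.
  by rewrite /rV_snoc mxE; case: unliftP => [j ->|->] /=.
rewrite product_measure1E//.
  rewrite (IHn (fun i => A (lift ord_max i)))// big_ord_recr/=; congr (_ * _)%E; apply: eq_bigr => i _.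
  congr (lebesgue_measure (A _)); apply/val_inj => /=.
  by rewrite /bump leqNgt ltn_ord.
rewrite (_ : mkset _ = \bigcap_(i in [set: 'I_n]) (rV_coord i @^-1` A (lift ord_max i))).
  apply: fin_bigcap_measurable => // i _.
  by rewrite -[X in measurable X]setTI; exact: measurable_rV_coord.
by apply/seteqP; split => [x Ax i _|x Ax i]; [exact: Ax|exact: Ax].
Qed.

(* The library norm on 'rV[R]_n is the sup norm. *)
Definition enorm (R : realType) (n : nat) (x : 'rV[R]_n) : R :=
  Num.sqrt (\sum_(i < n) x ord0 i ^+ 2).

Definition hom_dim (R : realType) (n : nat) : R := (n + 2)%:R.

Definition rho (R : realType) (n : nat) (z : 'rV[R]_n * R) : R :=
  (enorm z.1 ^+ 4 + 4 * z.2 ^+ 2) `^ 4^-1.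

Definition gauge_ball (R : realType) (n : nat) (r : R) : set ('rV[R]_n * R) :=
  [set z | rho z < r].

Definition partial_x (R : realType) (n : nat) (i : 'I_n)
    (f : 'rV[R]_n * R -> R) (z : 'rV[R]_n * R) : R :=
  'D_(delta_mx ord0 i, 0) f z.

Definition partial_t (R : realType) (n : nat)
    (f : 'rV[R]_n * R -> R) (z : 'rV[R]_n * R) : R :=
  'D_(0, 1) f z.

Definition grushin_grad (R : realType) (n : nat)
    (f : 'rV[R]_n * R -> R) (z : 'rV[R]_n * R) : 'rV[R]_n * R :=
  (\row_(i < n) partial_x i f z, enorm z.1 * partial_t f z).

Definition grad_norm (R : realType) (n : nat)
    (f : 'rV[R]_n * R -> R) (z : 'rV[R]_n * R) : R :=
  Num.sqrt (enorm (grushin_grad f z).1 ^+ 2 + (grushin_grad f z).2 ^+ 2).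

(* psi = |grushin_grad rho| ^ 2 away from the origin *)
Definition psi (R : realType) (n : nat) (z : 'rV[R]_n * R) : R :=
  enorm z.1 ^+ 2 / rho z ^+ 2.

(* The derivative in rho at fixed angles, for the polar coordinates
   x = rho * sqrt (sin phi) * w, t = rho ^ 2 / 2 * cos phi, |w| = 1. *)
Definition partial_rho (R : realType) (n : nat)
    (f : 'rV[R]_n * R -> R) (z : 'rV[R]_n * R) : R :=
  (rho z)^-1 *
    (\sum_(i < n) z.1 ord0 i * partial_x i f z + 2 * z.2 * partial_t f z).

Definition radial_grushin (R : realType) (n : nat)
    (f : 'rV[R]_n * R -> R) (z : 'rV[R]_n * R) : R :=
  psi z * (partial_rho (partial_rho f) z +
           (hom_dim R n - 1) / rho z * partial_rho f z).

Fixpoint C_k (R : realType) (n : nat) (k : nat) (f : 'rV[R]_n * R -> R) : Prop :=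
  match k with
  | 0 => continuous f
  | k'.+1 => (forall z, differentiable f z) /\
             (forall v, C_k k' (fun z => 'D_v f z))
  end.

(* C_0^infty(D): functions are extended by 0 outside D *)
Definition test_function (R : realType) (n : nat) (D : set ('rV[R]_n * R))
    (f : 'rV[R]_n * R -> R) : Prop :=
  let supp := closure [set z | f z != 0] in
  [/\ forall k, C_k k f, compact supp & supp `<=` D].

Definition volume (R : realType) (n : nat) :
    {measure set ('rV[R]_n * measurableTypeR R) -> \bar R} :=
  (lebesgue_rV R n \x @lebesgue_measure R)%E.

(* The integrands below are arbitrary (x / 0 = 0) on the null sets x = 0 and
   rho = exp (- 1 / r); all integrals are of nonnegative functions. *)

Definition rellich_term (R : realType) (n : nat) (p : R)
    (u : 'rV[R]_n * R -> R) : \bar R :=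
  (\int[volume R n]_(z in gauge_ball 1)
     (`|radial_grushin u z| `^ p /
      (grad_norm (@rho R n) z `^ p * rho z `^ (hom_dim R n - 2 * p)))%:E)%E.

Definition hardy_term (R : realType) (n : nat) (p : R)
    (u : 'rV[R]_n * R -> R) : \bar R :=
  (\int[volume R n]_(z in gauge_ball 1)
     (`|u z| `^ p * grad_norm (@rho R n) z `^ p /
      (rho z `^ hom_dim R n * ln (1 / rho z) `^ p))%:E)%E.

Definition d_C (R : realType) (n : nat) (p : R)
    (u : 'rV[R]_n * R -> R) (r : R) : \bar R :=
  ((\int[volume R n]_(z in gauge_ball 1)
     (`|u z - ln (1 / rho z) `^ ((p - 1) / p) * r `^ ((p - 1) / p) *
           u ((expR (- (1 / r)) / rho z) *: z.1,
              expR (- (2 / r)) * (z.2 / rho z ^+ 2))| `^ p /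
      (rho z `^ hom_dim R n * ln (1 / rho z) `^ p *
       `|ln (r * ln (1 / rho z))| `^ p) *
      grad_norm (@rho R n) z `^ p)%:E) `^ p^-1)%E.

(* For p >= 2 this infimum over the open interval is attained. *)
Definition c_min (R : realType) (p : R) : R :=
  inf [set (1 - tau) `^ p - tau `^ p + p * tau `^ (p - 1)
      | tau in [set tau : R | 0 < tau < 2^-1]].

Definition rellich_const (R : realType) (n : nat) (p : R) : R :=
  ((hom_dim R n - 2) * (p - 1) / p) `^ p.

(* Main.v *)
(* The integrals are compared orbit by orbit under the dilations
   (x, t) |-> (e^s x, e^(2s) t).  On the orbit of a point w with rho w = 1, put
   y = - ln rho and h y = |x_w| u; the integrands, multiplied by rho^Q, become
   |h'' - n h'|^p, |h|^p / y^p and |h - h (1/r) (r y)^k|^p / (y |ln (r y)|)^p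
   with k = (p - 1) / p, so a one-dimensional inequality on ]0, +oo[ suffices.
   It chains three pointwise inequalities of the form A >= B + G', each an
   instance of |a + b|^p >= |a|^p + p |a|^(p-2) a b + c_p |b|^p:
   - a = - n h', b = h'' bounds the Rellich term below by n^p |h'|^p;
   - a = k h / y, a + b = h' gives the Hardy term k^p |h / y|^p and a rest
     c_p |h' - k h / y|^p;
   - with m = h - h (1/r) (r y)^k, which has m' - k m / y = h' - k h / y,
     a = k m / (y ln (r y)) bounds that rest below by the remainder, separately
     on both sides of y = 1/r.
   The total derivatives G' integrate to zero or to terms of the right sign. *)
Require Import Defs.
From HB Require Import structures.
From mathcomp Require Import all_boot all_order all_algebra.
From mathcomp Require Import all_classical all_reals all_analysis.
From mathcomp Require Import measurable_realfun ring lra.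

Set Implicit Arguments.
Unset Strict Implicit.
Unset Printing Implicit Defensive.

Import Order.TTheory GRing.Theory Num.Theory.
Import numFieldNormedType.Exports.

Local Open Scope classical_set_scope.
Local Open Scope ring_scope.

(** * Lebesgue measure and dilations *)

(** With y = - ln rho, the operator rho d_rho becomes - d/dy, and since Q - 2 = n the radial
    operator becomes psi / rho^2 times (d/dy)^2 - n d/dy. The powers of rho in the three integrals
    are exactly those that cancel the Jacobian e^(-Q y). The function y^k solves f' = k f / y, so it
    is a virtual extremal of the Hardy inequality on the half-line; the remainder measures the
    distance of h from the multiple of y^k that meets h at y = 1/r. Because of this choice m
    vanishes where ln (r y) does, and the potential tends to 0 at 1/r from both sides. On the other
    hand m neither vanishes near 0 nor decays at infinity, so the outer ends are settled by the sign
    of the potential, which is that of ln (r y). The constant c_p arises from |a + b|^p - |a|^p - p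
    |a|^(p-2) a b normalised by b = 1: the critical range is a = - tau with 0 < tau < 1/2, where
    this is the expression minimised in [c_min]. The comparison is made with sums of nonnegative
    extended reals; the difference in the theorem is reached at the end, from the finiteness of the
    Hardy term. *)

Section affine.
Context {R : realType}.
Local Open Scope ereal_scope.
Notation mu := (@lebesgue_measure R).

Lemma measurable_affine (a b : R) :
  measurable_fun [set: measurableTypeR R]
    ((fun x => a * x + b)%R : measurableTypeR R -> measurableTypeR R).
Proof.
by apply: (@measurable_funD _ _ _ _ ( *%R a) (cst b)) => //; exact: mulrl_measurable.
Qed.

(** The image of Lebesgue measure under the affine map, multiplied by [a], gives half-open intervals
    their length, hence is Lebesgue measure. *)
Lemma ge0_integral_affine (a b : R) (f : R -> \bar R) :
  (0 < a)%R -> measurable_fun [set: measurableTypeR R] f ->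
  (forall x, 0 <= f x) ->
  \int[mu]_x f (a * x + b)%R = a^-1%:E * \int[mu]_x f x.
Proof.
move=> a0 mf f0.
pose h : measurableTypeR R -> measurableTypeR R := fun x => (a * x + b)%R.
have mh : measurable_fun setT h by exact: measurable_affine.
have a0' : (0 <= a)%R by exact: ltW.
pose mh' : {measure set (measurableTypeR R) -> \bar R} :=
  measure_function_pushforward__canonical__measure_function_Measure mu mh.
pose nu : {measure set (measurableTypeR R) -> \bar R} := mscale (NngNum a0') mh'.
have nuE A : measurable A -> mu A = nu A.
  apply: lebesgue_measure_unique => _ [[c d] _ <-].
  rewrite /= /mscale/= /pushforward.
  rewrite (_ : h @^-1` _ = `](c - b) / a, (d - b) / a]%classic)%R; last first.
    apply/seteqP; split => x; rewrite /h/= !in_itv/=;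
    by rewrite ltr_pdivrMr// ler_pdivlMr// ltrBlDr lerBrDr (mulrC x).
  rewrite !lebesgue_measure_itv/= !lte_fin ltr_pM2r ?invr_gt0// ltrD2r.
  case: ifPn => cd; last by rewrite mule0.
  rewrite -!EFinB -EFinM -mulrBl opprB addrA subrK mulrC.
  by rewrite divfK// gt_eqF.
rewrite [in RHS](eq_measure_integral nu); last by move=> A mA _; exact: nuE.
rewrite ge0_integral_mscale//= ge0_integral_pushforward//=.
by rewrite muleA -EFinM mulVf ?gt_eqF// mul1e.
Qed.
End affine.

Lemma measurable_rV_box (R : realType) (n : nat) (A : 'I_n -> set R) :
  (forall i, measurable (A i : set (measurableTypeR R))) ->
  measurable [set x : 'rV[R]_n | forall i, A i (x ord0 i)].
Proof.
move=> mA.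
rewrite (_ : mkset _ = \bigcap_(i in [set: 'I_n]) (rV_coord i @^-1` A i)).
  apply: fin_bigcap_measurable => // i _.
  by rewrite -[X in measurable X]setTI; exact: measurable_rV_coord.
by apply/seteqP; split => [x Ax i _|x Ax i]; [exact: Ax|exact: Ax].
Qed.

Lemma lebesgue_rV_sigma_finite (R : realType) (n : nat) :
  sigma_finite [set: 'rV[R]_n] (lebesgue_rV R n).
Proof.
exists (fun k => [set x : 'rV[R]_n | forall i, `[- k%:R, k%:R]%classic (x ord0 i)]).
  apply/esym/seteqP; split => // x _.
  (* A sum over the coordinates bounds each of them, so it indexes a cube that contains [x]. *)
  exists (\sum_(i < n) (Num.truncn `|x ord0 i|).+1)%N => // i /=.
  rewrite in_itv/= -ler_norml; apply: (le_trans (ltW (truncnS_gt _))).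
  by rewrite ler_nat (bigD1 i)//= leq_addr.
move=> k; split.
  by apply: (@measurable_rV_box _ _ (fun=> `[- k%:R, k%:R]%classic)) => i; exact: measurable_itv.
rewrite (@lebesgue_rV_box _ _ (fun=> `[- k%:R, k%:R]%classic)); last first.
  by move=> i; exact: measurable_itv.
rewrite (eq_bigr (fun=> (k%:R + k%:R)%:E))%E; last first.
  move=> i _; rewrite lebesgue_measure_itv/= lte_fin.
  case: ifPn => [_|]; first by rewrite opprK.
  by rewrite -leNgt => ?; congr EFin; have := ler0n R k; lra.
by rewrite prodEFin ltry.
Qed.

(* The same set function as lebesgue_rV, as a carrier for the sigma-finite structure. *)
Definition sigma_finite_rV (R : realType) (n : nat) : set 'rV[R]_n -> \bar R :=
  lebesgue_rV R n.

HB.instance Definition _ (R : realType) (n : nat) :=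
  isMeasure.Build _ _ _ (@sigma_finite_rV R n) (measure0 (lebesgue_rV R n))
    (measure_ge0 (lebesgue_rV R n)) (@measure_semi_sigma_additive _ _ _ (lebesgue_rV R n)).

HB.instance Definition _ (R : realType) (n : nat) :=
  Measure_isSigmaFinite.Build _ _ _ (@sigma_finite_rV R n) (@lebesgue_rV_sigma_finite R n).

Section dilations.
Local Open Scope ereal_scope.

Lemma measurable_scale_rV (R : realType) (n : nat) (c : R) :
  measurable_fun [set: 'rV[R]_n] (fun x : 'rV[R]_n => c *: x)%R.
Proof.
apply: measurable_fun_rV => i; rewrite /rV_coord.
under eq_fun do rewrite mxE.
by apply: measurableT_comp (mulrl_measurable _) (measurable_rV_coord i).
Qed.

(** Induction on the dimension: Tonelli's theorem splits off the last coordinate, which contributes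
    one factor [c^-1]. In dimension 0 there is a single point, fixed by every scaling. *)
Lemma ge0_integral_rV_scale (R : realType) (n : nat) (c : R)
    (f : 'rV[R]_n -> \bar R) :
  (0 < c)%R -> measurable_fun setT f -> (forall x, 0 <= f x) ->
  \int[lebesgue_rV R n]_x f (c *: x)%R =
  (c ^- n)%:E * \int[lebesgue_rV R n]_x f x.
Proof.
move=> c0; elim: n f => [|n IHn] f mf f0.
  rewrite expr0 invr1 mul1e; apply: eq_integral => x _.
  by congr f; apply/rowP => -[].
pose g (z : 'rV[R]_n * measurableTypeR R) := f (rV_snoc z).
have mg : measurable_fun setT g.
  exact: (measurableT_comp mf (@measurable_rV_snoc R n)).
(* The measure on n + 1 coordinates is by construction the image of a product, so its integrals are
   iterated ones; [sigma_finite_rV] supplies the sigma-finiteness for Tonelli's theorem. *)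
have stepE (h : 'rV[R]_n.+1 -> \bar R) : measurable_fun setT h ->
    (forall x, 0 <= h x) ->
    \int[lebesgue_rV R n.+1]_x h x =
    \int[lebesgue_rV R n]_x \int[lebesgue_measure]_t h (rV_snoc (x, t)).
  move=> mh h0.
  rewrite [LHS](@ge0_integral_pushforward _ _ _ _ _ _ (@measurable_rV_snoc R n)
    (@sigma_finite_rV R n \x @lebesgue_measure R) setT)//.
  rewrite preimage_setT.
  rewrite (@fubini_tonelli1 _ _ _ _ _ _ _ (h \o @rV_snoc R n))//.
    exact: (measurableT_comp mh (@measurable_rV_snoc R n)).
  by move=> z; exact: h0.
have snocZ x (t : R) : (c *: rV_snoc (x, t) = rV_snoc (c *: x, c * t))%R.
  apply/rowP => i; rewrite /rV_snoc !mxE /=.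
  by case: unlift => [j|]//=; rewrite mxE.
rewrite !stepE//; last exact: (measurableT_comp mf (measurable_scale_rV c)).
under eq_integral => x _ do under eq_integral => t _ do rewrite snocZ.
have mG : measurable_fun [set: 'rV[R]_n] (fun x => \int[lebesgue_measure]_t g (x, t)).
  by apply: (measurable_fun_fubini_tonelli_F g) => // z; exact: f0.
have gx x : measurable_fun [set: measurableTypeR R] (fun t => g (x, t)).
  exact: (measurableT_comp mg (measurable_pair1 x)).
transitivity (\int[lebesgue_rV R n]_x
    (c^-1%:E * \int[lebesgue_measure]_t g (c *: x, t)%R)).
  apply: eq_integral => x _.
  rewrite -(@ge0_integral_affine _ c 0 (fun t => g (c *: x, t)%R))//.
    by apply: eq_integral => t _; rewrite addr0.
  by move=> t; exact: f0.
rewrite [LHS](ge0_integralZl (lebesgue_rV R n) measurableT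
  (f := fun x => \int[lebesgue_measure]_t g (c *: x, t)%R))//; first last.
- by rewrite lee_fin invr_ge0 ltW.
- by move=> x _; apply: integral_ge0 => t _; exact: f0.
- exact: (measurableT_comp mG (measurable_scale_rV c)).
rewrite (IHn (fun x => \int[lebesgue_measure]_t g (x, t)))//; last first.
  by move=> x; apply: integral_ge0 => t _; exact: f0.
by rewrite muleA -EFinM -invfM -exprS.
Qed.

(** The parameter is the logarithm of the scaling factor, which makes the dilations an additive
    group and lets orbit integrals use Lebesgue measure in [s]. *)
Definition dil (R : realType) (n : nat) (s : R) (z : 'rV[R]_n * R) : 'rV[R]_n * R :=
  (expR s *: z.1, expR s ^+ 2 * z.2)%R.

(** The Jacobian e^(Q s) collects n factors e^s from [x] and a factor e^(2s) from [t], whence Q = n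
    + 2. *)
Lemma ge0_integral_dil (R : realType) (n : nat) (s : R)
    (f : 'rV[R]_n * measurableTypeR R -> \bar R) :
  measurable_fun setT f -> (forall z, 0 <= f z) ->
  \int[volume R n]_z f (dil s z) =
  (expR (- (hom_dim R n * s)))%:E * \int[volume R n]_z f z.
Proof.
move=> mf f0.
have es0 : (0 < expR s)%R by exact: expR_gt0.
have md : measurable_fun setT
    (@dil R n s : 'rV[R]_n * measurableTypeR R -> 'rV[R]_n * measurableTypeR R).
  apply: measurable_fun_pair => /=.
    exact: (measurableT_comp (measurable_scale_rV _) measurable_fst).
  by apply: (@measurable_funM _ _ _ _ (cst (expR s ^+ 2)%R) snd).
have fx x : measurable_fun [set: measurableTypeR R] (fun t => f (x, t)).
  exact: (measurableT_comp mf (measurable_pair1 x)).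
have stepE h : measurable_fun setT h -> (forall z, 0 <= h z) ->
   \int[volume R n]_z h z = \int[lebesgue_rV R n]_x \int[lebesgue_measure]_t h (x, t).
  by move=> mh h0; rewrite [LHS](@fubini_tonelli1 _ _ _ _ _ (@sigma_finite_rV R n)).
rewrite !stepE//; last exact: (measurableT_comp mf md).
pose F x := \int[lebesgue_measure]_t f (x, t).
have mF : measurable_fun [set: 'rV[R]_n] F.
  by apply: (measurable_fun_fubini_tonelli_F f).
have F0 x : 0 <= F x by exact: integral_ge0.
transitivity (\int[lebesgue_rV R n]_x ((expR s ^- 2)%:E * F (expR s *: x)%R)).
  apply: eq_integral => x _.
  rewrite -(@ge0_integral_affine _ (expR s ^+ 2) 0 (fun t => f (expR s *: x, t)%R))//.
    by apply: eq_integral => t _; rewrite addr0.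
  by rewrite exprn_gt0.
rewrite [LHS](ge0_integralZl (lebesgue_rV R n) measurableT (f := fun x => F (expR s *: x)%R))//; first last.
  exact: (measurableT_comp mF (measurable_scale_rV _)).
by rewrite ge0_integral_rV_scale// muleA -EFinM -invfM -exprD expRN expRM_natl addnC.
Qed.

End dilations.

Section volume_box.
Context (R : realType) (n : nat).

Definition box (k : nat) : set ('rV[R]_n * measurableTypeR R) :=
  [set x : 'rV[R]_n | forall i, (`[- k%:R, k%:R]%classic : set R) (x ord0 i)] `*`
  (`[- k%:R, k%:R]%classic : set R).

Lemma measurable_box k : measurable (box k).
Proof.
apply: measurableX; last exact: measurable_itv.
by apply: (@measurable_rV_box _ _ (fun=> `[- k%:R, k%:R]%classic)) => i; exact: measurable_itv.
Qed.

Lemma volume_box_lty k : (volume R n (box k) < +oo)%E.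
Proof.
have muB : @lebesgue_measure R `[- k%:R, k%:R]%classic = (k%:R + k%:R)%:E.
  rewrite lebesgue_measure_itv/= lte_fin.
  case: ifPn => [_|]; first by rewrite opprK.
  by rewrite -leNgt => ?; congr EFin; have := ler0n R k; lra.
rewrite [X in (X < _)%E]product_measure1E//; last first.
  apply: (@measurable_rV_box _ _ (fun=> `[- k%:R, k%:R]%classic)) => i.
  exact: measurable_itv.
rewrite (@lebesgue_rV_box _ _ (fun=> `[- k%:R, k%:R]%classic))//.
by rewrite muB (eq_bigr (fun=> (k%:R + k%:R)%:E))%E// prodEFin [X in (_ * X < _)%E]muB -EFinM ltry.
Qed.

Lemma volume_sigma_finite :
  sigma_finite [set: 'rV[R]_n * measurableTypeR R] (volume R n).
Proof.
exists box; last by move=> k; split; [exact: measurable_box|exact: volume_box_lty].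
apply/esym/seteqP; split => // -[x t] _.
exists ((\sum_(i < n) (Num.truncn `|x ord0 i|).+1) + (Num.truncn `|t|).+1)%N => //.
split => [i|] /=; rewrite in_itv/= -ler_norml;
  apply: (le_trans (ltW (truncnS_gt _))); rewrite ler_nat.
  by rewrite (bigD1 i)//= -addnA leq_addr.
by rewrite leq_addl.
Qed.

End volume_box.

(** A name for the volume that can carry the sigma-finite structure. *)
Definition sigma_finite_volume (R : realType) (n : nat) :
  set ('rV[R]_n * measurableTypeR R) -> \bar R := volume R n.

HB.instance Definition _ (R : realType) (n : nat) :=
  isMeasure.Build _ _ _ (@sigma_finite_volume R n) (measure0 (volume R n))
    (measure_ge0 (volume R n)) (@measure_semi_sigma_additive _ _ _ (volume R n)).

HB.instance Definition _ (R : realType) (n : nat) :=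
  Measure_isSigmaFinite.Build _ _ _ (@sigma_finite_volume R n) (@volume_sigma_finite R n).

(** * Comparison of integrals through dilation orbits *)

Section polar_comparison.
Local Open Scope ereal_scope.
Context (R : realType) (n : nat).
Notation mu := (@lebesgue_measure R).
Notation X := ('rV[R]_n * measurableTypeR R)%type.

Lemma measurable_dil : measurable_fun [set: X * measurableTypeR R]
  (fun w : X * measurableTypeR R => dil w.2 w.1 : X).
Proof.
apply: measurable_fun_pair => /=.
  apply: measurable_fun_rV => i; rewrite /rV_coord.
  under eq_fun do rewrite mxE.
  apply: measurable_funM.
    exact: (measurableT_comp (@measurable_expR R) measurable_snd).
  apply: (measurableT_comp (measurable_rV_coord i)).
  exact: (measurableT_comp measurable_fst measurable_fst).
apply: measurable_funM.
  apply: measurable_funX.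
  exact: (measurableT_comp (@measurable_expR R) measurable_snd).
exact: (measurableT_comp measurable_snd measurable_fst).
Qed.

Variable L : X -> R.
Hypothesis mL : measurable_fun [set: X] L.

Let chi (w : X * measurableTypeR R) : R := (\1_(`[0, 1[%classic) (L w.1 + w.2))%R.

Let measurable_chi : measurable_fun setT chi.
Proof.
have h1 : measurable_fun [set: measurableTypeR R] (\1_(`[0%R, 1%R[%classic) : R -> R).
  by apply: measurable_indic.
apply: (measurableT_comp h1); apply: measurable_funD; last exact: measurable_snd.
exact: (measurableT_comp mL measurable_fst).
Qed.

Let int_chi z : \int[mu]_s (chi (z, s))%:E = 1.
Proof.
rewrite (_ : (fun s => _) = fun s => (\1_(`[(- L z)%R, (1 - L z)%R[%classic) s)%:E); last first.
  apply/funext => s; rewrite /chi !indicE; congr (_%:R%:E).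
  apply: (congr1 nat_of_bool); apply/idP/idP; rewrite !inE/= !in_itv/= => /andP[? ?]; apply/andP; split; lra.
rewrite integral_indic//= setIT lebesgue_measure_itv/= lte_fin ifT; last lra.
by rewrite -EFinB; congr EFin; lra.
Qed.

Let Tint (f : X -> \bar R) z :=
  \int[mu]_s ((expR (- (hom_dim R n * s)))%:E * f (dil (- s) z) * (chi (dil (- s) z, s))%:E).

Let measurable_integrand (f : X -> \bar R) : measurable_fun setT f ->
  measurable_fun setT (fun w : X * measurableTypeR R =>
    (expR (- (hom_dim R n * w.2)))%:E * f (dil (- w.2) w.1) *
    (chi (dil (- w.2) w.1, w.2))%:E).
Proof.
move=> mf.
have mN : measurable_fun setT (fun w : X * measurableTypeR R => dil (- w.2) w.1 : X).
  have h1 : measurable_fun setT (fun w : X * measurableTypeR R => (w.1, - w.2)%R).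
    apply: measurable_fun_pair; first exact: measurable_fst.
    by apply: measurable_funN; exact: measurable_snd.
  exact: (measurableT_comp measurable_dil h1).
apply: emeasurable_funM.
  apply: emeasurable_funM; last exact: (measurableT_comp mf mN).
  apply/measurable_EFinP; apply: (measurableT_comp (@measurable_expR R)).
  apply: measurable_funN; apply: measurable_funM => //; exact: measurable_snd.
apply/measurable_EFinP; apply: (measurableT_comp measurable_chi).
apply: measurable_fun_pair => //; exact: measurable_snd.
Qed.

(** The weight [chi] is inserted, the integrals are exchanged, [dil (- s)] is substituted at fixed
    [s], which produces e^(-Q s), and the integrals are exchanged back. *)
Let integral_polar (f : X -> \bar R) :
  measurable_fun setT f -> (forall z, 0 <= f z) ->
  \int[volume R n]_z f z = \int[volume R n]_z Tint f z.
Proof.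
move=> mf f0.
have chi0 w : 0 <= (chi w)%:E by rewrite lee_fin /chi indicE.
have mfchi : measurable_fun setT
    (fun w : X * measurableTypeR R => f w.1 * (chi w)%:E).
  apply: emeasurable_funM; last exact/measurable_EFinP.
  exact: (measurableT_comp mf measurable_fst).
pose V := @sigma_finite_volume R n.
transitivity (\int[V]_z \int[mu]_s (f z * (chi (z, s))%:E)).
  apply: eq_integral => z _.
  rewrite ge0_integralZl//.
  - by rewrite int_chi mule1.
  - apply/measurable_EFinP; exact: (measurableT_comp measurable_chi (measurable_pair1 z)).
rewrite [LHS](@fubini_tonelli _ _ _ _ _ (@sigma_finite_volume R n) mu (fun w => f w.1 * (chi w)%:E))//; last first.
  by move=> w; rewrite mule_ge0.
pose F (w : X * measurableTypeR R) := (expR (- (hom_dim R n * w.2)))%:E *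
  f (dil (- w.2) w.1) * (chi (dil (- w.2) w.1, w.2))%:E.
have mF : measurable_fun setT F by exact: measurable_integrand.
have F0 w : 0 <= F w by rewrite !mule_ge0// lee_fin expR_ge0.
transitivity (\int[V]_z \int[mu]_s F (z, s)); last by [].
rewrite [RHS](@fubini_tonelli _ _ _ _ _ (@sigma_finite_volume R n) mu F mF F0).
rewrite {mF F0}/F.
apply: eq_integral => s _ /=.
pose h (z : X) := f z * (chi (z, s))%:E.
have mh : measurable_fun setT h := measurableT_comp mfchi (measurable_pair2 s).
have h0 z : 0 <= h z by rewrite mule_ge0.
transitivity (\int[volume R n]_z ((expR (- (hom_dim R n * s)))%:E * h (dil (- s) z))).
  rewrite [RHS]ge0_integralZl//.
  - by rewrite ge0_integral_dil// muleA -EFinM -expRD mulrN opprK addrC subrr expR0 mul1e.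
  - have mp : measurable_fun [set: X] (fun z : X => (z, (- s)%R) : X * measurableTypeR R).
      exact: measurable_pair2.
    have md : measurable_fun [set: X] (fun z : X => dil (- s) z : X).
      exact: (measurableT_comp measurable_dil mp).
    exact: (measurableT_comp mh md).
by apply: eq_integral => z _; rewrite muleA.
Qed.

Hypothesis L_dil : forall (z : 'rV[R]_n * R) (s : R), z != 0%R -> L (dil s z) = (L z + s)%R.

(* A polar-coordinate comparison without surface measure: the weight
   s |-> 1_[0,1[ (L z + s) has integral 1 for every z, so Tonelli's theorem and
   the dilation rule turn an integral over the space into an integral of line
   integrals along the dilation orbits. *)
Lemma ge0_le_integral_orbits (f g : X -> \bar R) :
  measurable_fun setT f -> measurable_fun setT g ->
  (forall z, 0 <= f z) -> (forall z, 0 <= g z) -> f 0%R = 0 ->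
  (forall z : 'rV[R]_n * R, z != 0%R ->
    \int[mu]_s ((expR (- (hom_dim R n * s)))%:E * f (dil (- s) z)) <=
    \int[mu]_s ((expR (- (hom_dim R n * s)))%:E * g (dil (- s) z))) ->
  \int[volume R n]_z f z <= \int[volume R n]_z g z.
Proof.
move=> mf mg f0 g0 f00 fg.
have chi0 w : 0 <= (chi w)%:E by rewrite lee_fin /chi indicE.
have T0 h z : (forall z, 0 <= h z) -> 0 <= Tint h z.
  by move=> h0; apply: integral_ge0 => s _; rewrite !mule_ge0// lee_fin expR_ge0.
have mT h : measurable_fun setT h -> (forall z, 0 <= h z) -> measurable_fun setT (Tint h).
  move=> mh h0; apply: (measurable_fun_fubini_tonelli_F (fun w : X * measurableTypeR R =>
    (expR (- (hom_dim R n * w.2)))%:E * h (dil (- w.2) w.1) *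
    (chi (dil (- w.2) w.1, w.2))%:E)).
    exact: measurable_integrand.
  by move=> w; rewrite !mule_ge0// lee_fin expR_ge0.
rewrite (integral_polar mf f0) (integral_polar mg g0).
apply: ge0_le_integral => //; [by move=> z _; exact: T0|exact: mT|exact: mT|].
(* The origin is fixed by the dilations, so [L] cannot grow along its orbit; there [f 0 = 0] makes
   the left side vanish. *)
move=> z _; have [->|z0] := eqVneq (z : 'rV[R]_n * R) 0%R.
  rewrite /Tint integral0_eq ?T0// => s _.
  by rewrite /dil/= scaler0 mulr0 f00 mule0 mul0e.
(* Along the orbit [L] changes by exactly the amount that the shift by [s] restores, so the weight
   is constant and comes out of the integral. *)
have chiE s : chi (dil (- s) z, s) = chi (z, 0%R).
  by rewrite /chi/= L_dil// addr0 subrK.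
have TE h : measurable_fun setT h -> (forall z, 0 <= h z) -> Tint h z =
   \int[mu]_s ((expR (- (hom_dim R n * s)))%:E * h (dil (- s) z)) * (chi (z, 0%R))%:E.
  move=> mh h0; rewrite /Tint.
  under eq_integral do rewrite chiE.
  rewrite ge0_integralZr//.
  - apply: emeasurable_funM.
      apply/measurable_EFinP; apply: (measurableT_comp (@measurable_expR R)).
      by apply: measurable_funN; exact: mulrl_measurable.
    have mp : measurable_fun [set: measurableTypeR R]
        (fun s : measurableTypeR R => (z, (- s)%R) : X * measurableTypeR R).
      by apply: measurable_fun_pair => //; exact: oppr_measurable.
    have md : measurable_fun [set: measurableTypeR R] (fun s => dil (- s) z : X).
      exact: (measurableT_comp measurable_dil mp).
    exact: (measurableT_comp mh md).
  - by move=> s _; rewrite !mule_ge0// lee_fin expR_ge0.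
by rewrite !TE// lee_wpmul2r// fg.
Qed.

End polar_comparison.

(** Links the topology with the sigma-algebra of the coordinate maps: an open set is the countable
    union of the boxes with rational centre and radius 1/(k+1) that it contains. *)
Lemma open_measurable_rVR (R : realType) (n : nat) (U : set ('rV[R]_n * R)) :
  open U -> measurable (U : set ('rV[R]_n * measurableTypeR R)).
Proof.
move=> oU.
pose e (k : nat) : R := k.+1%:R^-1.
pose box (q : 'rV[rat]_n * rat * nat) : set ('rV[R]_n * R) :=
  [set x : 'rV[R]_n | forall i, ball (ratr (q.1.1 ord0 i) : R) (e q.2) (x ord0 i)] `*`
  ball (ratr q.1.2 : R) (e q.2).
rewrite (_ : U = \bigcup_q (if `[< box q `<=` U >] then box q else set0)).
  apply: countable_bigcupT_measurable => // q; case: ifP => // _.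
  apply: measurableX; last exact: measurable_ball.
  apply: (@measurable_rV_box _ _ (fun i => ball (ratr (q.1.1 ord0 i) : R) (e q.2))) => i.
  exact: measurable_ball.
apply/seteqP; split => [[x t] Uxt|z [q _]]; last first.
  by case: ifPn => // /asboolP qU; exact: qU.
have /nbhs_ballP[r /= r0 rU] := open_nbhs_nbhs (conj oU Uxt).
(* Half of [r], because two points of one box may differ by almost [2 * e k] in a coordinate. *)
have [k kr] : exists k, e k < r / 2.
  exists (Num.truncn (2 / r)); rewrite /e -[ltRHS]invrK ltf_pV2 ?posrE//.
    by rewrite invf_div truncnS_gt.
  by rewrite invr_gt0 divr_gt0.
have ek : 0 < e k by rewrite invr_gt0.
have ratP (y : R) : exists q : rat, ball (ratr q : R) (e k) y.
  have /rat_in_itvoo[q] : y - e k < y + e k by lra.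
  by rewrite in_itv/= => /andP[? ?]; exists q; rewrite /ball/= ltr_distl; lra.
pose a := \row_(i < n) projT1 (cid (ratP (x ord0 i))).
have [b bt] := ratP t.
have xa i : ball (ratr (a ord0 i) : R) (e k) (x ord0 i).
  by rewrite mxE; exact: (projT2 (cid (ratP (x ord0 i)))).
have qU : box (a, b, k) `<=` U.
  move=> [y s] [/= ay bs]; apply: rU; split => /=.
    split => // i j; rewrite (ord1 i); have := xa j; have := ay j.
    by rewrite /ball/= !ltr_norml => /andP[? ?] /andP[? ?]; lra.
  by move: bt bs; rewrite /ball/= !ltr_norml => /andP[? ?] /andP[? ?]; lra.
by exists (a, b, k) => //; rewrite asboolT.
Qed.

Lemma continuous_measurable_rVR (R : realType) (n : nat) (f : 'rV[R]_n * R -> R) :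
  continuous f -> measurable_fun setT (f : 'rV[R]_n * measurableTypeR R -> R).
Proof.
move=> /continuousP cf.
apply: (measurability _ (RGenOpens.measurableE R)) => //.
move=> _ [_ [a [b ->] <-]]; rewrite setTI; apply: open_measurable_rVR.
by apply: cf; exact: interval_open.
Qed.

(** * The power function and the constant c_p *)

Section power.
Context {R : realType}.
Implicit Types p q x y a b t : R.

Lemma derive_ge0_le (f df : R -> R) (a b : R) : a <= b ->
  (forall x, x \in `]a, b[ -> is_derive x 1 f (df x) /\ 0 <= df x) ->
  {within `[a, b], continuous f} -> f a <= f b.
Proof.
rewrite le_eqVlt => /predU1P[->//|ab] fdf cf.
have [c cab] := MVT ab (fun x xab => (fdf x xab).1) cf.
rewrite -subr_ge0 => ->; rewrite mulr_ge0 ?subr_ge0 ?(ltW ab)//.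
by have [] := fdf c cab.
Qed.

Lemma derive_ge0_le_closed (f df : R -> R) (a b : R) : a <= b ->
  (forall x, x \in `[a, b] -> is_derive x 1 f (df x) /\ 0 <= df x) ->
  f a <= f b.
Proof.
move=> ab fdf; apply: (derive_ge0_le (df := df)) => // [x xab|].
  by apply: fdf; apply: subset_itv_oo_cc xab.
apply: derivable_within_continuous => x xab.
by have [? _] := fdf x xab; exact: ex_derive.
Qed.

Lemma is_derive_cast (f g : R -> R) x df dg :
  is_derive x 1 f df -> f =1 g -> df = dg -> is_derive x 1 g dg.
Proof. by move=> + /funext <- <-. Qed.

(** Off 0 this is the power rule on either side; at 0, [p >= 2] gives |h|^p <= h^2 for |h| <= 1, so
    the difference quotient is at most |h|. *)
Lemma is_derive_abs_powR p x : 2 <= p ->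
  is_derive x 1 (fun x => `|x| `^ p) (p * `|x| `^ (p - 2) * x).
Proof.
move=> p2.
have pE y : 0 < y -> p * y `^ (p - 1) = p * y `^ (p - 2) * y.
  move=> y0; rewrite (_ : p - 1 = p - 2 + 1); last by ring.
  by rewrite powRD ?powRr1 ?mulrA ?(ltW y0)// (gt_eqF y0) implybT.
have [x0|x0|->] := ltgtP x 0.
- have nx0 : 0 < - x by rewrite oppr_gt0.
  apply: (@near_eq_is_derive _ _ _ (fun x => (- x) `^ p)).
    near=> y; rewrite ltr0_norm//; near: y; exact: lt_nbhsl.
  have H : is_derive (- x) 1 (fun y => y `^ p) (p * (- x) `^ (p - 1)).
    exact: is_derive1_powR.
  have := @is_derive1_comp _ (fun y => y `^ p) -%R x _ _ H (is_deriveNid x 1).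
  by rewrite pE// ltr0_norm// mulrN1 mulrN opprK.
- apply: (@near_eq_is_derive _ _ _ (fun x => x `^ p)).
    near=> y; rewrite gtr0_norm//; near: y; exact: lt_nbhsr.
  by rewrite gtr0_norm// -pE//; exact: is_derive1_powR.
rewrite mulr0.
pose f x := `|x| `^ p.
have cv : h^-1 * (f h - f 0) @[h --> 0^'] --> 0.
  apply/cvgrPdist_le => e e0; near=> h.
  have h0 : 0 < `|h| by rewrite normr_gt0; near: h; exact: nbhs_dnbhs_neq.
  have h1 : `|h| <= 1 by near: h; apply: dnbhs0_le; exact: ltr01.
  have he : `|h| <= e by near: h; apply: dnbhs0_le.
  rewrite sub0r normrN /f normr0 powR0 ?subr0; last by apply: lt0r_neq0; lra.
  rewrite normrM normfV ger0_norm ?powR_ge0// (le_trans _ he)// ler_pdivrMl//.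
  have -> : `|h| * `|h| = `|h| `^ 2 by rewrite powR_mulrn// expr2.
  by rewrite ger_powR// h0.
have cv' : h^-1 *: (f (h *: 1 + 0) - f 0) @[h --> 0^'] --> (0 : R^o).
  by under eq_fun do rewrite addr0 [_ *: 1]mulr1.
apply: DeriveDef; first by apply/cvg_ex; exists 0.
exact/cvg_lim.
Unshelve. all: by end_near. Qed.

(** Young's inequality for the product of [r] and 1, with the conjugate exponents q and q / (q -
    1). *)
Lemma bernoulli_powR (q r : R) : 1 <= q -> 0 <= r -> 1 + q * (r - 1) <= r `^ q.
Proof.
move=> q1 r0; have [->|q1'] := eqVneq q 1; first by rewrite powRr1//; lra.
have q1'' : 1 < q by rewrite lt_neqAle eq_sym q1'.
have q0 : 0 < q by lra.
have q10 : 0 < q - 1 by lra.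
have := @conjugate_powR R r 1 q (q / (q - 1)) r0 ler01 q0.
rewrite divr_gt0// powR1 mulr1 invf_div => /(_ isT).
have -> : q^-1 + (q - 1) / q = 1 by field; rewrite gt_eqF.
move=> /(_ erefl); rewrite mul1r -mulrDl ler_pdivlMr//; lra.
Qed.

(** Bernoulli's inequality at x / y, multiplied by y^q. *)
Lemma tangent_powR (q x y : R) : 1 <= q -> 0 <= x -> 0 < y ->
  y `^ q + q * y `^ (q - 1) * (x - y) <= x `^ q.
Proof.
move=> q1 x0 y0; have y0' := ltW y0.
have -> : x `^ q = y `^ q * (x / y) `^ q.
  by rewrite -powRM ?divr_ge0// mulrCA divff ?mulr1// gt_eqF.
have -> : y `^ q = y `^ (q - 1) * y.
  by rewrite mulrC mulr_powRB1//; lra.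
rewrite -[leLHS](_ : y `^ (q - 1) * y * (1 + q * (x / y - 1)) = _); last first.
  by field; rewrite gt_eqF.
by rewrite ler_wpM2l ?mulr_ge0 ?powR_ge0// bernoulli_powR// divr_ge0.
Qed.

(** The value of |a + b|^p - |a|^p - p |a|^(p-2) a b at a = - t, b = 1, for t between 0 and 1. *)
Let gap p t := (1 - t) `^ p - t `^ p + p * t `^ (p - 1).

Let gap_ge0 p t : 0 <= p -> 0 < t < 2^-1 -> 0 <= gap p t.
Proof.
move=> p0 /andP[t0 t1]; rewrite /gap addr_ge0//; last by rewrite mulr_ge0// powR_ge0.
by rewrite subr_ge0 ge0_ler_powR// ?nnegrE; lra.
Qed.

Lemma c_min_ge0 p : 2 <= p -> 0 <= c_min p.
Proof.
move=> p2; apply: lb_le_inf.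
  by exists (gap p 4^-1), 4^-1 => //=; lra.
by move=> _ [t /= t01 <-]; apply: gap_ge0 => //; lra.
Qed.

Let c_min_le_gap p t : 2 <= p -> 0 < t < 2^-1 -> c_min p <= gap p t.
Proof.
move=> p2 t01; apply: ge_inf; last by exists t.
by exists 0 => _ [s /= s01 <-]; apply: gap_ge0 => //; lra.
Qed.

(** [gap p t] tends to 1 as t tends to 0: the chosen [t] gives p t^(p-1) <= p t <= e, while (1 -
    t)^p <= 1. *)
Let c_min_le1 p : 2 <= p -> c_min p <= 1.
Proof.
move=> p2; apply/ler_addgt0Pl => e e0.
pose t := Num.min 4^-1 (e / p).
have p0 : 0 < p by lra.
have t0 : 0 < t by rewrite lt_min invr_gt0 divr_gt0// andbT; lra.
have t4 : t <= 4^-1 by rewrite ge_min lexx.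
have te : p * t <= e by rewrite mulrC -ler_pdivlMr// ge_min lexx orbT.
apply: (le_trans (@c_min_le_gap p t p2 _)); first by rewrite t0/=; lra.
have h1 : (1 - t) `^ p <= 1 `^ p by rewrite ge0_ler_powR// ?nnegrE; lra.
rewrite powR1 in h1.
have h2 : t `^ (p - 1) <= t.
  by rewrite -[leRHS]powRr1 ?(ltW t0)// ger_powR ?t0//; lra.
have h3 : p * t `^ (p - 1) <= p * t by rewrite ler_pM2l.
have := powR_ge0 t p; rewrite /gap; lra.
Qed.

Let norm_powRB2 p x : 0 < x -> `|x| `^ (p - 2) * x = x `^ (p - 1).
Proof.
move=> x0; rewrite gtr0_norm// (_ : p - 1 = p - 2 + 1); last by ring.
by rewrite [in RHS]powRD ?(gt_eqF x0) ?implybT// powRr1// ltW.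
Qed.

(** The absolute values continue [gap] past t = 1, where 1 - t changes sign. *)
Let gapN p t := `|1 - t| `^ p - `|t| `^ p + p * t `^ (p - 1).

Let is_derive_gapN p t : 2 <= p -> 0 < t -> is_derive t 1 (gapN p)
  (p * (`|1 - t| `^ (p - 2) * (t - 1) - t `^ (p - 1) + (p - 1) * t `^ (p - 2))).
Proof.
move=> p2 t0.
have h1 : is_derive t 1 (fun t => 1 - t) (-1).
  by apply: is_derive_eq; rewrite add0r mul1r.
have := @is_derive1_comp _ (fun x => `|x| `^ p) (fun t => 1 - t) _ _ _ (is_derive_abs_powR (1 - t) p2) h1.
have := is_derive_abs_powR t p2.
have := @is_derive1_powR _ (p - 1) t t0.
move=> d1 d2 d3.
apply: (is_derive_cast (is_deriveD (is_deriveB d3 d2) (is_deriveZ p d1))) => //.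
rewrite -[X in _ - X]mulrA norm_powRB2// /GRing.scale/=.
by rewrite (_ : p - 1 - 1 = p - 2); ring.
Qed.

(** [gapN] is nondecreasing from 1/2 on, and its value at 1/2 is a limit of values over the open
    interval of the infimum. *)
Let c_min_le_gapN p t : 2 <= p -> 2^-1 <= t -> c_min p <= gapN p t.
Proof.
move=> p2 t2.
have h2 : c_min p <= gapN p 2^-1.
  have /is_derive_gapN - /(_ p p2) d : 0 < 2^-1 :> R by lra.
  have c : {for 2^-1, continuous (gapN p)}.
    by apply/differentiable_continuous/derivable1_diffP; exact: ex_derive.
  apply/ler_addgt0Pl => e e0.
  move/cvgrPdist_lt : c => /(_ e e0).
  case/nbhs_ballP => d0 /= d00 dP.
  (* Left of 1/2 and within the continuity radius [d0]; the bound 1/4 keeps it positive. *)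
  pose s := Num.max 4^-1 (2^-1 - d0 / 2).
  have s2 : s < 2^-1 by rewrite gt_max; apply/andP; split; lra.
  have s4 : 4^-1 <= s by rewrite le_max lexx.
  have sd : 2^-1 - d0 / 2 <= s by rewrite le_max lexx orbT.
  have /dP : ball (2^-1 : R) d0 s by rewrite /ball/= gtr0_norm; [lra|rewrite subr_gt0].
  rewrite /= ltr_distl => /andP[gs _].
  clearbody s.
  have gE : gapN p s = gap p s by rewrite /gapN /gap !ger0_norm//; lra.
  have s01 : 0 < s < 2^-1 by rewrite s2 andbT; lra.
  have := c_min_le_gap p2 s01; rewrite -gE => cs.
  by apply: (le_trans cs); rewrite -lerBlDl ltW.
apply: (le_trans h2).
apply: derive_ge0_le_closed t2 _ => x; rewrite in_itv/= => /andP[x2 _].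
have x0 : 0 < x by lra.
split; first exact: is_derive_gapN.
apply: mulr_ge0; first lra.
(* For 1/2 <= x <= 1, [1 - x <= x] leaves at least (p - 2) x^(p - 2). Beyond 1 the claim is that the
   power p - 1 lies above its tangent at x, read at x - 1. *)
have [x1|x1] := leP x 1.
  have e1 : x `^ (p - 1) = x `^ (p - 2) * x by rewrite -norm_powRB2// gtr0_norm.
  have e2 : `|1 - x| `^ (p - 2) <= x `^ (p - 2).
    by rewrite ger0_norm ?subr_ge0// ge0_ler_powR// ?nnegrE; lra.
  have e3 := powR_ge0 x (p - 2); rewrite e1.
  have e4 : `|1 - x| `^ (p - 2) * (1 - x) <= x `^ (p - 2) * (1 - x).
    by rewrite ler_wpM2r// subr_ge0.
  nra.
have -> : `|1 - x| `^ (p - 2) * (x - 1) = (x - 1) `^ (p - 1).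
  by rewrite distrC norm_powRB2// subr_gt0.
have := @tangent_powR (p - 1) (x - 1) x; rewrite (_ : p - 1 - 1 = p - 2); last by ring.
move=> /(_ _ _ x0); rewrite (_ : x - 1 - x = -1); last by ring.
by move=> H; have := H ltac:(lra) ltac:(lra); lra.
Qed.

(** The function [H] tends to 1 at 0 and is nondecreasing, by convexity of the power p - 1. The
    comparison starts from a small s > 0, inside the range of the power rule. *)
Let powR_add1_ge p t : 2 <= p -> 0 < t ->
  t `^ p + p * t `^ (p - 1) + 1 <= (t + 1) `^ p.
Proof.
move=> p2 t0; apply/ler_addgt0Pl => e e0.
pose s := Num.min (Num.min 1 t) e.
have s0 : 0 < s by rewrite !lt_min t0 ltr01 e0.
have s1 : s <= 1 by rewrite !ge_min lexx.
have st : s <= t by rewrite !ge_min lexx orbT.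
have se : s <= e by rewrite !ge_min lexx orbT.
pose H t : R := (t + 1) `^ p - t `^ p - p * t `^ (p - 1).
have Hs : 1 - s <= H s.
  rewrite /H.
  have := @bernoulli_powR p (s + 1) ltac:(lra) ltac:(lra); rewrite addrK => b1.
  have b2 : s `^ p <= s.
    by rewrite -[leRHS]powRr1 ?(ltW s0)// ger_powR ?s0//; lra.
  have b3 : s `^ (p - 1) <= s.
    by rewrite -[leRHS]powRr1 ?(ltW s0)// ger_powR ?s0//; lra.
  have b4 : p * s `^ (p - 1) <= p * s by rewrite ler_wpM2l//; lra.
  lra.
suff : H s <= H t by rewrite /H in Hs *; lra.
apply: (derive_ge0_le_closed (df := fun x =>
  p * ((x + 1) `^ (p - 1) - x `^ (p - 1) - (p - 1) * x `^ (p - 2)))) => // x.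
rewrite in_itv/= => /andP[sx _]; have x0 : 0 < x by lra.
split.
  have x10 : 0 < x + 1 by lra.
  have h1 : is_derive x 1 (fun x => x + 1) 1 by exact: is_derive_shift.
  have := @is_derive1_comp _ (fun x => x `^ p) (fun x => x + 1) _ _ _ (is_derive1_powR p x10) h1.
  have := @is_derive1_powR _ (p - 1) x x0.
  have := @is_derive1_powR _ p x x0.
  move=> d1 d2 d3.
  apply: (is_derive_cast (is_deriveB (is_deriveB d3 d1) (is_deriveZ p d2))) => //.
  by rewrite /GRing.scale/= (_ : p - 1 - 1 = p - 2); ring.
apply: mulr_ge0; first lra.
have := @tangent_powR (p - 1) (x + 1) x ltac:(lra) ltac:(lra) x0.
rewrite (_ : p - 1 - 1 = p - 2); last by ring.
rewrite (_ : x + 1 - x = 1); last by ring.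
lra.
Qed.

(** Three ranges: for t >= 0 even the constant 1 works, and it dominates [c_min p]; for t <= -1/2
    the monotonicity of [gapN] applies; in between the claim is the definition of the infimum. *)
Let c_min_powR_add1 p t : 2 <= p ->
  `|t| `^ p + p * `|t| `^ (p - 2) * t + c_min p <= `|t + 1| `^ p.
Proof.
move=> p2.
have [t0|t0|->] := ltgtP t 0; last first.
- by rewrite add0r normr0 normr1 powR1 powR0 ?mulr0 ?add0r ?c_min_le1//; apply: lt0r_neq0; lra.
- rewrite -mulrA norm_powRB2// !gtr0_norm//; last lra.
  have := powR_add1_ge p2 t0; have := c_min_le1 p2; lra.
pose s := - t; have s0 : 0 < s by rewrite oppr_gt0.
have -> : t = - s by rewrite opprK.
rewrite normrN mulrN -mulrA norm_powRB2// (addrC (- s)).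
have [s2|s2] := leP 2^-1 s.
  by have := c_min_le_gapN p2 s2; rewrite /gapN; lra.
have := @c_min_le_gap p s p2; rewrite s0 s2 => /(_ isT).
by rewrite /gap !ger0_norm; lra.
Qed.

(** Both sides are homogeneous of degree p in the pair a, b, which reduces the claim to b = 1. *)
Lemma c_min_powR_add p a b : 2 <= p ->
  `|a| `^ p + p * `|a| `^ (p - 2) * a * b + c_min p * `|b| `^ p <= `|a + b| `^ p.
Proof.
move=> p2; have [->|b0] := eqVneq b 0.
  by rewrite normr0 powR0 ?mulr0 ?addr0//; apply: lt0r_neq0; lra.
have [t ->] : exists t, a = t * b by exists (a / b); rewrite divfK.
have bp : 0 < `|b| by rewrite normr_gt0.
rewrite -[X in `|_ + X|]mul1r -mulrDl !normrM !powRM//.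
have e1 : `|b| `^ p = `|b| `^ (p - 2) * (b * b).
  rewrite [in LHS](_ : p = p - 2 + 2); last by ring.
  rewrite [in LHS]powRD ?(gt_eqF bp) ?implybT// powR_mulrn//.
  by rewrite real_normK ?num_real// expr2.
have := c_min_powR_add1 t p2; rewrite -(ler_pM2r (powR_gt0 p bp)).
rewrite e1 => H; apply: le_trans H.
by rewrite le_eqVlt; apply/orP; left; apply/eqP; ring.
Qed.

Lemma abs_powR_tangent p a b : 2 <= p ->
  `|a| `^ p + p * `|a| `^ (p - 2) * a * b <= `|a + b| `^ p.
Proof.
move=> p2; apply: le_trans (c_min_powR_add a b p2).
by rewrite lerDl mulr_ge0 ?powR_ge0// c_min_ge0.
Qed.

End power.

(** * One-dimensional inequalities *)

Section comparison.
Context {R : realType}.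
Notation mu := (@lebesgue_measure R).
Implicit Types (A B G dG : R -> R) (a b c d : R).

Let is_cont_integrable f c d : {in `[c, d], forall x : R, {for x, continuous f}} ->
  mu.-integrable `[c, d] (EFin \o f).
Proof.
move=> cf; apply: continuous_compact_integrable; first exact: segment_compact.
by apply: continuous_in_subspaceT => x; rewrite inE => /cf.
Qed.

(** The integral of A - B, minus G, has the nonnegative derivative A - B - dG. Monotonicity replaces
    an integration of [dG], which is known only as a pointwise derivative. *)
Lemma ge0_integral_le_segment A B G dG c d : c <= d ->
  {in `[c, d], forall x : R, {for x, continuous A}} ->
  {in `[c, d], forall x : R, {for x, continuous B}} ->
  {in `[c, d], forall x : R, is_derive x 1 G (dG x)} ->
  {in `[c, d], forall x : R, B x + dG x <= A x} ->
  (\int[mu]_(x in `[c, d]) (B x)%:E <=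
   \int[mu]_(x in `[c, d]) (A x)%:E + (G c - G d)%:E)%E.
Proof.
move=> cd cA cB dGG BA.
have iA := is_cont_integrable cA; have iB := is_cont_integrable cB.
pose D x := A x - B x.
have cD : {in `[c, d], forall x : R, {for x, continuous D}}.
  by move=> x xcd; apply: continuousB; [exact: cA|exact: cB].
have iD := is_cont_integrable cD.
pose H x := \int[mu]_(t in `[c, x]) D t - G x.
have cG : {within `[c, d], continuous G}.
  by apply: derivable_within_continuous => x /dGG ?; exact: ex_derive.
have : H c <= H d.
  apply: (derive_ge0_le (df := fun x => D x - dG x)) => //; last first.
    have := parameterized_integral_continuous cd iD.
    by move=> cI; exact: (within_continuousB cI cG).
  move=> x xcd; have xcd' : x \in `[c, d] by exact: subset_itv_oo_cc xcd.
  split; last by rewrite /D; have := BA x xcd'; lra.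
  have [cx xd] := andP xcd; rewrite !bnd_simp in cx xd.
  have [dI dIE] := continuous_FTC1_closed xd iD cx (cD x xcd').
  pose I x := \int[mu]_(t in `[c, x]) D t.
  rewrite derive1E in dIE.
  have dI' : is_derive x 1 I (D x) by exact: (DeriveDef dI dIE).
  exact: (is_derive_cast (is_deriveB dI' (dGG x xcd'))).
rewrite /H set_itv1 Rintegral_set1 RintegralB// => HH.
rewrite -[leLHS]fineK ?integrable_fin_num//.
rewrite -[X in (_ <= X + _)%E]fineK ?integrable_fin_num//.
rewrite -EFinD lee_fin; move: HH; rewrite /Rintegral; lra.
Qed.

(** The integral of B is the limit over the segments, and each segment is enlarged to a later one
    whose boundary term is at most [e]. Both integrals may be infinite. *)
Lemma ge0_integral_le_exhaust A B G dG (c d : nat -> R) :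
  (forall k, c k <= d k) -> nonincreasing_seq c -> nondecreasing_seq d ->
  let U := \bigcup_k `[c k, d k]%classic in
  (forall x : R, U x -> [/\ {for x, continuous A}, {for x, continuous B},
     is_derive x 1 G (dG x), 0 <= B x & B x + dG x <= A x]) ->
  (forall x, U x -> 0 <= A x) ->
  (forall k (e : R), 0 < e -> exists2 j, (k <= j)%N & G (c j) - G (d j) <= e) ->
  (\int[mu]_(x in U) (B x)%:E <= \int[mu]_(x in U) (A x)%:E)%E.
Proof.
move=> cd cc dd U HU A0 HG.
have inU k x : `[c k, d k]%classic x -> U x by exists k.
have ndF : nondecreasing_seq (fun k => `[c k, d k]%classic).
  move=> i j ij; rewrite subsetEset; apply: subset_itv; rewrite bnd_simp.
    exact: cc.
  exact: dd.
have mF k : measurable (`[c k, d k]%classic : set (measurableTypeR R)).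
  exact: measurable_itv.
have mU : measurable (U : set (measurableTypeR R)) by exact: bigcupT_measurable.
have iA k : mu.-integrable `[c k, d k] (EFin \o A).
  by apply: is_cont_integrable => x /inU/HU[].
have iB k : mu.-integrable `[c k, d k] (EFin \o B).
  by apply: is_cont_integrable => x /inU/HU[].
have mA : measurable_fun (U : set (measurableTypeR R)) (EFin \o A).
  apply/measurable_fun_bigcup => // k; exact: measurable_int (iA k).
have := ge0_nondecreasing_set_cvg_integral (mu := mu) ndF mF
  (fun k => measurable_int _ (iB k)).
have B0 i x : `[c i, d i]%classic x -> (0 <= (EFin \o B) x)%E.
  by move=> /inU/HU[_ _ _ ? _]; rewrite lee_fin.
move=> /(_ B0) cvgB.
rewrite -[leLHS](cvg_lim _ cvgB)//; apply: lime_le; first exact: cvgP cvgB.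
apply: nearW => k; apply/lee_addgt0Pr => e e0.
have [j kj Gj] := HG k e e0.
apply: (@le_trans _ _ (\int[mu]_(x in `[c j, d j]) (B x)%:E)%E).
  apply: ge0_subset_integral => //; first exact: measurable_int (iB j).
  - by move=> x /B0.
  - by rewrite -subsetEset; exact: ndF.
apply: (@le_trans _ _ (\int[mu]_(x in `[c j, d j]) (A x)%:E + (G (c j) - G (d j))%:E)%E).
  by apply: (ge0_integral_le_segment (dG := dG)) => // x /inU/HU[].
apply: leeD; last by rewrite lee_fin.
apply: ge0_subset_integral => //; last by move=> x; exact: inU.
Qed.

Let bigcup_halfline (a : R) :
  \bigcup_k `[a + k.+1%:R^-1, a + k.+1%:R]%classic = `]a, +oo[%classic.
Proof.
apply/seteqP; split => x /=.
  move=> [k _] /=; rewrite !in_itv/= andbT => /andP[+ _].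
  by apply: lt_le_trans; rewrite ltrDl invr_gt0.
rewrite in_itv/= andbT => ax.
exists (Num.truncn (x - a) + Num.truncn (x - a)^-1)%N => //=; rewrite in_itv/=.
have xa0 : 0 < x - a by rewrite subr_gt0.
apply/andP; split; last rewrite -lerBlDl.
  rewrite -lerBrDl -[leRHS]invrK lef_pV2 ?posrE ?invr_gt0//.
  by apply: (le_trans (ltW (truncnS_gt _))); rewrite ler_nat ltnS leq_addl.
by apply: (le_trans (ltW (truncnS_gt _))); rewrite ler_nat ltnS leq_addr.
Qed.

(** The boundary term is G near [a] minus G far out, so an upper bound [e] at the first end and the
    sign of G at the other suffice. *)
Lemma ge0_integral_le_halfline A B G dG a :
  (forall x : R, a < x -> [/\ {for x, continuous A}, {for x, continuous B},
     is_derive x 1 G (dG x), 0 <= B x & B x + dG x <= A x]) ->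
  (forall x, a < x -> 0 <= A x) ->
  (forall e : R, 0 < e -> exists2 r : R, 0 < r & forall s, a < s < a + r -> G s <= e) ->
  (exists M, forall t, M < t -> 0 <= G t) ->
  (\int[mu]_(x in `]a, +oo[) (B x)%:E <= \int[mu]_(x in `]a, +oo[) (A x)%:E)%E.
Proof.
move=> HU A0 Ga [M GM].
have inU x : `]a, +oo[%classic x -> a < x by rewrite /= in_itv/= andbT.
rewrite -bigcup_halfline; apply: (ge0_integral_le_exhaust (G := G) (dG := dG)).
- move=> k; rewrite lerD2l (@le_trans _ _ 1)// ?ler1n//.
  by rewrite invf_le1 ?ler1n.
- by move=> i j ij; rewrite lerD2l lef_pV2 ?posrE// ler_nat ltnS.
- by move=> i j ij; rewrite lerD2l ler_nat ltnS.
- by rewrite bigcup_halfline => x /inU; exact: HU.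
- by rewrite bigcup_halfline => x /inU; exact: A0.
move=> k e e0; have [r r0 Gr] := Ga e e0.
exists (k + Num.truncn r^-1 + Num.truncn (`|M - a|)%R)%N; first by rewrite -addnA leq_addr.
set j := (_ + _)%N.
have G1 : G (a + j.+1%:R^-1) <= e.
  apply: Gr; rewrite ltrDl invr_gt0 ltr0n/= ltrD2l.
  rewrite -[ltRHS]invrK ltf_pV2 ?posrE ?invr_gt0//.
  apply: (lt_le_trans (truncnS_gt _)); rewrite ler_nat ltnS /j.
  by rewrite addnAC leq_addl.
have G2 : 0 <= G (a + j.+1%:R).
  apply: GM; rewrite -ltrBlDl (le_lt_trans (ler_norm _))//.
  apply: (lt_le_trans (truncnS_gt _)); rewrite ler_nat ltnS /j.
  by rewrite leq_addl.
lra.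
Qed.

(** Starting the denominators at 2 makes every segment nonempty, as 1/(k + 2) <= 1/2. *)
Let bigcup_segment (b : R) : 0 < b ->
  \bigcup_k `[b * k.+2%:R^-1, b * (1 - k.+2%:R^-1)]%classic = `]0, b[%classic.
Proof.
move=> b0; apply/seteqP; split => x /=.
  move=> [k _] /=; rewrite !in_itv/= => /andP[k1 k2]; apply/andP; split.
    by apply: lt_le_trans k1; rewrite mulr_gt0 ?invr_gt0.
  by apply: (le_lt_trans k2); rewrite gtr_pMr// gtrDl oppr_lt0 invr_gt0.
rewrite in_itv/= => /andP[x0 xb].
pose y := x / b.
have y0 : 0 < y by rewrite divr_gt0.
have y1 : y < 1 by rewrite ltr_pdivrMr ?mul1r.
have -> : x = b * y by rewrite mulrC divfK// gt_eqF.
exists (Num.truncn y^-1 + Num.truncn (1 - y)^-1)%N => //=; rewrite in_itv/=.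
rewrite !ler_pM2l//; set k := (_ + _)%N.
have h (z : R) : 0 < z -> (Num.truncn z^-1 <= k)%N -> k.+2%:R^-1 <= z.
  move=> z0 zk; rewrite -[leRHS]invrK lef_pV2 ?posrE ?invr_gt0//.
  by apply: (le_trans (ltW (truncnS_gt _))); rewrite ler_nat ltnS ltnW.
have h1 := h y y0 (leq_addr _ _).
have h2 := h (1 - y) ltac:(lra) (leq_addl _ _).
by rewrite h1/= lerBrDl -lerBrDr.
Qed.

(** Mirror image of the half-line case: the sign of G settles the end 0, and a lower bound - e the
    end [b]. *)
Lemma ge0_integral_le_segment0 A B G dG (b : R) : 0 < b ->
  (forall x : R, 0 < x < b -> [/\ {for x, continuous A}, {for x, continuous B},
     is_derive x 1 G (dG x), 0 <= B x & B x + dG x <= A x]) ->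
  (forall x, 0 < x < b -> 0 <= A x) ->
  (exists2 r : R, 0 < r & forall s, 0 < s < r -> G s <= 0) ->
  (forall e : R, 0 < e -> exists2 r : R, 0 < r & forall t, b - r < t < b -> - e <= G t) ->
  (\int[mu]_(x in `]0%R, b[) (B x)%:E <= \int[mu]_(x in `]0%R, b[) (A x)%:E)%E.
Proof.
move=> b0 HU A0 [r r0 Gr] Gb.
have inU x : `]0, b[%classic x -> 0 < x < b by rewrite /= in_itv.
have k12 (k : nat) : k.+2%:R^-1 <= 2^-1 :> R by rewrite lef_pV2 ?posrE// ler_nat.
rewrite -(bigcup_segment b0); apply: (ge0_integral_le_exhaust (G := G) (dG := dG)).
- by move=> k; rewrite ler_pM2l//; move: (k12 k); move: (_^-1) => z; lra.
- by move=> i j ij; rewrite ler_pM2l// lef_pV2 ?posrE// ler_nat !ltnS.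
- by move=> i j ij; rewrite ler_pM2l// lerB// lef_pV2 ?posrE// ler_nat !ltnS.
- by rewrite bigcup_segment// => x /inU; exact: HU.
- by rewrite bigcup_segment// => x /inU; exact: A0.
move=> k e e0; have [r' r'0 Gr'] := Gb e e0.
exists (k + Num.truncn (r / b)^-1 + Num.truncn (r' / b)^-1)%N; first by rewrite -addnA leq_addr.
set j := (_ + _)%N.
have h (z : R) : 0 < z -> (Num.truncn (z / b)^-1 <= j)%N -> b * j.+2%:R^-1 < z.
  move=> z0 zk; rewrite mulrC -ltr_pdivlMr// -[ltRHS]invrK ltf_pV2 ?posrE ?invr_gt0 ?divr_gt0//.
  by apply: (lt_le_trans (truncnS_gt _)); rewrite ler_nat ltnS ltnW.
have h1 : b * j.+2%:R^-1 < r by apply: h => //; rewrite /j addnAC leq_addl.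
have h2 : b * j.+2%:R^-1 < r' by apply: h => //; rewrite /j leq_addl.
have h0 : 0 < b * j.+2%:R^-1 by rewrite mulr_gt0 ?invr_gt0.
have G1 : G (b * j.+2%:R^-1) <= 0 by apply: Gr; rewrite h0.
have G2 : - e <= G (b * (1 - j.+2%:R^-1))
  by apply: Gr'; rewrite mulrBr mulr1 ltrD2l ltrN2 h2 ltrBlDr ltrDl h0.
lra.
Qed.
End comparison.

(** * Hardy inequality with a variable weight *)

Section hardy.
Context {R : realType}.
Implicit Types p k m dm W dW b x y : R.

Lemma is_derive_near (f : R -> R) x df e : is_derive x 1 f df -> f x = 0 -> 0 < e ->
  exists2 r, 0 < r & forall y, `|y - x| < r -> `|f y - df * (y - x)| <= e * `|y - x|.
Proof.
move=> [dv dfE] fx0 e0.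
have : h^-1 *: (f (h *: 1 + x) - f x) @[h --> 0^'] --> df by rewrite -dfE.
move=> /cvgrPdist_le/(_ e e0)/nbhs_ballP[r /= r0 rP].
exists r => // y yr; have [->|yx] := eqVneq y x.
  by rewrite subrr mulr0 subr0 fx0 !normr0 mulr0.
have yx0 : y - x != 0 by rewrite subr_eq0.
have b0 : ball (0 : R) r (y - x) by rewrite /ball/= sub0r normrN.
have := rP _ b0 yx0 => /=.
rewrite [_ *: 1]mulr1 subrK fx0 subr0 /GRing.scale/=.
move=> H; have : `|(y - x)^-1 * f y - df| * `|y - x| <= e * `|y - x|.
  by rewrite ler_wpM2r// distrC.
by rewrite -normrM mulrBl mulrAC mulVf// mul1r.
Qed.

(** On each side of 0 the function is |x|^(1-p) up to sign. Both signs occur because y ln (y / y0)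
    is negative below y0. *)
Lemma is_derive_mul_abs_powRN p x : x != 0 ->
  is_derive x 1 (fun x => x * `|x| `^ (- p)) ((1 - p) * `|x| `^ (- p)).
Proof.
have pE y : 0 < y -> y * y `^ (- p) = y `^ (1 - p).
  by move=> y0; rewrite powRD ?powRr1 ?ltW// (gt_eqF y0) implybT.
have dE y : 0 < y -> (1 - p) * y `^ (1 - p - 1) = (1 - p) * y `^ (- p).
  by move=> y0; congr (_ * _ `^ _); ring.
rewrite neq_lt => /orP[x0|x0].
- have nx0 : 0 < - x by rewrite oppr_gt0.
  apply: (@near_eq_is_derive _ _ _ (fun x => - ((- x) `^ (1 - p)))).
    near=> y; have y0 : y < 0 by near: y; exact: lt_nbhsl.
    by rewrite ltr0_norm// -pE ?oppr_gt0// mulNr opprK.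
  have H := @is_derive1_powR _ (1 - p) _ nx0.
  have H2 := @is_derive1_comp _ (fun y => y `^ (1 - p)) -%R x _ _ H (is_deriveNid x 1).
  apply: (is_derive_cast (is_deriveN H2)) => //.
  by rewrite dE// ltr0_norm// mulrN1 opprK.
- apply: (@near_eq_is_derive _ _ _ (fun x => x `^ (1 - p))).
    near=> y; have y0 : 0 < y by near: y; exact: lt_nbhsr.
    by rewrite gtr0_norm// -pE.
  by rewrite gtr0_norm// -dE//; exact: is_derive1_powR.
Unshelve. all: by end_near. Qed.

(* The potential of the total derivative in [hardy_pointwise]: W y = y gives the
   weight y^-p, and W y = y * ln (y / y0) the logarithmic remainder weight. *)
Definition hardy_pot p (m W : R -> R) y : R :=
  ((p - 1) / p) `^ (p - 1) * (`|m y| `^ p * (W y * `|W y| `^ (- p))).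

(** The derivative of [hardy_pot] in terms of the values of m, W and their derivatives, so that the
    pointwise inequality becomes pure algebra. *)
Definition hardy_dpot p m dm W dW : R :=
  ((p - 1) / p) `^ (p - 1) *
  (p * `|m| `^ (p - 2) * m * dm * (W * `|W| `^ (- p)) +
   `|m| `^ p * ((1 - p) * `|W| `^ (- p) * dW)).

Lemma is_derive_hardy_pot p (m W : R -> R) y dm dW : 2 <= p -> W y != 0 ->
  is_derive y 1 m dm -> is_derive y 1 W dW ->
  is_derive y 1 (hardy_pot p m W) (hardy_dpot p (m y) dm (W y) dW).
Proof.
move=> p2 W0 Dm DW.
have H1 := @is_derive1_comp _ (fun x => `|x| `^ p) m y _ _
  (is_derive_abs_powR (m y) p2) Dm.
have H2 := @is_derive1_comp _ (fun x => x * `|x| `^ (- p)) W y _ _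
  (is_derive_mul_abs_powRN p W0) DW.
apply: (is_derive_cast (is_deriveZ (((p - 1) / p) `^ (p - 1)) (is_deriveM H1 H2))) => //.
by rewrite /hardy_dpot /GRing.scale/=; ring.
Qed.

(** With k = (p - 1) / p, the hypothesis on [b] says b - B = m' - k m W' / W, and p k = p - 1 then
    makes the cross term p |B|^(p-2) B (b - B) exactly the derivative of the potential. For W = y
    this means b = m'; for W = y ln (y / y0) it means b = m' - k m / y. *)
Lemma hardy_pointwise p m dm W dW b : 2 <= p -> W != 0 ->
  W * b = W * dm - (p - 1) / p * m * (dW - 1) ->
  forall B, B = (p - 1) / p * m / W ->
  `|B| `^ p + c_min p * `|b - B| `^ p + hardy_dpot p m dm W dW <= `|b| `^ p.
Proof.
move=> p2 W0 Wb B BE.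
have p0 : 0 < p by lra.
have pn0 : p != 0 by rewrite gt_eqF.
have [k kE] : exists k, (p - 1) / p = k by exists ((p - 1) / p).
have k0 : 0 < k by rewrite -kE divr_gt0//; lra.
rewrite /hardy_dpot kE in Wb BE *.
have aW : 0 < `|W| by rewrite normr_gt0.
have := @c_min_powR_add _ p B (b - B) p2; rewrite [B + (b - B)]addrC subrK.
suff -> : p * `|B| `^ (p - 2) * B * (b - B) = k `^ (p - 1) * (p * `|m| `^ (p - 2) * m * dm * (W * `|W| `^ (- p)) +
   `|m| `^ p * ((1 - p) * `|W| `^ (- p) * dW)) by lra.
pose D := `|W| `^ (- p); pose M := `|m| `^ (p - 2).
have eM : `|m| `^ p = M * m * m.
  have [->|m0] := eqVneq m 0; first by rewrite normr0 powR0// !mulr0.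
  have am : 0 < `|m| by rewrite normr_gt0.
  rewrite [in LHS](_ : p = p - 2 + 2); last by ring.
  rewrite [in LHS]powRD ?(gt_eqF am) ?implybT// powR_mulrn//.
  by rewrite real_normK ?num_real// expr2 mulrA.
have eW : `|W|^-1 `^ (p - 2) = D * W * W.
  rewrite -powR_inv1// -powRrM (_ : -1 * (p - 2) = - p + 2); last by ring.
  rewrite powRD ?(gt_eqF aW) ?implybT// powR_mulrn//.
  by rewrite real_normK ?num_real// expr2 mulrA.
have ek : k `^ (p - 1) = k `^ (p - 2) * k.
  rewrite (_ : p - 1 = p - 2 + 1); last by ring.
  by rewrite powRD ?(gt_eqF k0) ?implybT// powRr1// ltW.
have eB : `|B| `^ (p - 2) = k `^ (p - 2) * M * (D * W * W).
  by rewrite BE !normrM normfV (gtr0_norm k0) !powRM ?mulr_ge0 ?invr_ge0 ?(ltW k0)// eW.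
rewrite eB ek eM -/D -/M BE.
have -> : b = dm - k * m * (dW - 1) / W by rewrite -[LHS](mulKf W0) Wb; field.
have -> : 1 - p = - (k * p) by rewrite -kE; field.
by move: (k `^ (p - 2)) => K; field.
Qed.
End hardy.

Section line.
Context {R : realType}.
Notation mu := (@lebesgue_measure R).
Implicit Types (p x y : R) (m dm W dW b f : R -> R).

Lemma is_derive1_continuous f x df : is_derive x 1 f df -> {for x, continuous f}.
Proof.
by move=> ?; apply/differentiable_continuous/derivable1_diffP; exact: ex_derive.
Qed.

Lemma continuous_abs_powR p f x : 2 <= p -> {for x, continuous f} ->
  {for x, continuous (fun y => `|f y| `^ p)}.
Proof.
move=> p2 cf; apply: (@continuous_comp _ _ _ f (fun y => `|y| `^ p)) => //.
exact: is_derive1_continuous (is_derive_abs_powR _ p2).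
Qed.

(** Where m vanishes and W has a simple zero, |m|^p |W|^-p stays bounded and the remaining factor W
    tends to 0. *)
Lemma hardy_pot_near p m (dm : R) W y0 : 2 <= p -> is_derive y0 1 m dm ->
  is_derive y0 1 W 1 -> m y0 = 0 -> W y0 = 0 -> forall e : R, 0 < e ->
  exists2 r : R, 0 < r & forall y, `|y - y0| < r -> `|hardy_pot p m W y| <= e.
Proof.
move=> p2 Dm DW m0 W0 e e0.
have [r1 r10 H1] := is_derive_near Dm m0 ltr01.
have half0 : 0 < 2^-1 :> R by lra.
have [r2 r20 H2] := is_derive_near DW W0 half0.
(* From |m y| <= (|dm| + 1) |y - y0| and |y - y0| <= 2 |W y|; the last factor 2 of [C] comes from |W
   y| <= 2 |y - y0|. *)
pose M : R := 2 * (`|dm| + 1).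
have M0 : 0 < M by rewrite mulr_gt0// ltr_wpDl.
pose C := ((p - 1) / p) `^ (p - 1) * M `^ p * 2.
have C0 : 0 < C by rewrite !mulr_gt0 ?powR_gt0// divr_gt0; lra.
exists (Num.min r1 (Num.min r2 (e / C))); first by rewrite !lt_min r10 r20 divr_gt0.
move=> y; rewrite !lt_min => /and3P[yr1 yr2 yC].
have {H1} mM : `|m y| <= (`|dm| + 1) * `|y - y0|.
  have := H1 y yr1; rewrite mul1r => h1.
  have := ler_normD (m y - dm * (y - y0)) (dm * (y - y0)); rewrite subrK normrM; lra.
have := H2 y yr2; rewrite mul1r => {}H2.
have W1 : `|y - y0| <= 2 * `|W y|.
  have := ler_normD (y - y0 - W y) (W y); rewrite subrK [`|y - y0 - W y|]distrC; lra.
have W2 : `|W y| <= 2 * `|y - y0|.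
  have := ler_normD (W y - (y - y0)) (y - y0); rewrite subrK.
  have := normr_ge0 (y - y0); lra.
have [Wy|Wy] := eqVneq (W y) 0.
  by rewrite /hardy_pot Wy mul0r !mulr0 normr0 ltW.
have Wp : 0 < `|W y| by rewrite normr_gt0.
have mW : `|m y| `^ p <= M `^ p * `|W y| `^ p.
  rewrite -powRM ?(ltW M0)// ge0_ler_powR ?nnegrE ?mulr_ge0 ?(ltW M0)//; first by lra.
  apply: (le_trans mM); rewrite /M -mulrA mulrCA ler_wpM2l// ?addr_ge0//.
have mWD : `|m y| `^ p * `|W y| `^ (- p) <= M `^ p.
  by rewrite powRN ler_pdivrMr// powR_gt0.
rewrite /hardy_pot !normrM !(ger0_norm (powR_ge0 _ _)).
have -> : `|m y| `^ p * (`|W y| * `|W y| `^ (- p)) =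
          `|m y| `^ p * `|W y| `^ (- p) * `|W y| by ring.
apply: (@le_trans _ _ (C * `|y - y0|)); last first.
  by rewrite mulrC -ler_pdivlMr// ltW.
have h : `|m y| `^ p * `|W y| `^ (- p) * `|W y| <= M `^ p * (2 * `|y - y0|).
  by rewrite ler_pM// mulr_ge0 ?powR_ge0.
by rewrite /C -[leRHS]mulrA -[leRHS]mulrA ler_wpM2l ?powR_ge0.
Qed.

(** The term in c_p is dropped. The potential tends to 0 at [y0] and has the sign of W, so it is
    nonnegative far out even when [m] does not decay. *)
Lemma hardy_right p m dm W dW b y0 : 2 <= p ->
  (forall y, y0 < y -> [/\ is_derive y 1 m (dm y), is_derive y 1 W (dW y), 0 < W y,
     {for y, continuous b} &
     W y * b y = W y * dm y - (p - 1) / p * m y * (dW y - 1)]) ->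
  is_derive y0 1 m (dm y0) -> m y0 = 0 -> is_derive y0 1 W 1 -> W y0 = 0 ->
  (\int[mu]_(y in `]y0, +oo[) (`|(p - 1) / p * m y / W y| `^ p)%:E <=
   \int[mu]_(y in `]y0, +oo[) (`|b y| `^ p)%:E)%E.
Proof.
move=> p2 H Dm0 m0 DW0 W0.
apply: (ge0_integral_le_halfline (G := hardy_pot p m W)
   (dG := fun y => hardy_dpot p (m y) (dm y) (W y) (dW y))).
- move=> y y0y; have [Dm DW Wy cb E] := H y y0y.
  have Wn0 : W y != 0 by rewrite gt_eqF.
  split; [exact: continuous_abs_powR| |exact: is_derive_hardy_pot|exact: powR_ge0|].
    apply: continuous_abs_powR => //; apply: continuousM.
      by apply: continuousM; [exact: cst_continuous|exact: is_derive1_continuous Dm].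
    by apply: continuousV => //; exact: is_derive1_continuous DW.
  have := hardy_pointwise p2 Wn0 E erefl.
  have := mulr_ge0 (c_min_ge0 p2) (powR_ge0 `|b y - (p - 1) / p * m y / W y| p).
  lra.
- by move=> y _; exact: powR_ge0.
- move=> e e0; have [r r0 rP] := hardy_pot_near p2 Dm0 DW0 m0 W0 e0.
  exists r => // s /andP[s1 s2]; apply: (le_trans (ler_norm _)); apply: rP.
  by rewrite gtr0_norm ?subr_gt0// ltrBlDl.
- exists y0 => t y0t; have [_ _ Wt _ _] := H t y0t.
  by rewrite /hardy_pot !mulr_ge0 ?powR_ge0// ltW.
Qed.

(** Here W < 0 makes the potential nonpositive near 0, the favourable sign at a lower end. *)
Lemma hardy_left p m dm W dW b y0 : 2 <= p -> 0 < y0 ->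
  (forall y, 0 < y < y0 -> [/\ is_derive y 1 m (dm y), is_derive y 1 W (dW y), W y < 0,
     {for y, continuous b} &
     W y * b y = W y * dm y - (p - 1) / p * m y * (dW y - 1)]) ->
  is_derive y0 1 m (dm y0) -> m y0 = 0 -> is_derive y0 1 W 1 -> W y0 = 0 ->
  (\int[mu]_(y in `]0%R, y0[) (`|(p - 1) / p * m y / W y| `^ p)%:E <=
   \int[mu]_(y in `]0%R, y0[) (`|b y| `^ p)%:E)%E.
Proof.
move=> p2 y00 H Dm0 m0 DW0 W0.
apply: (ge0_integral_le_segment0 (G := hardy_pot p m W)
   (dG := fun y => hardy_dpot p (m y) (dm y) (W y) (dW y))) => //.
- move=> y y0y; have [Dm DW Wy cb E] := H y y0y.
  have Wn0 : W y != 0 by rewrite lt_eqF.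
  split; [exact: continuous_abs_powR| |exact: is_derive_hardy_pot|exact: powR_ge0|].
    apply: continuous_abs_powR => //; apply: continuousM.
      by apply: continuousM; [exact: cst_continuous|exact: is_derive1_continuous Dm].
    by apply: continuousV => //; exact: is_derive1_continuous DW.
  have := hardy_pointwise p2 Wn0 E erefl.
  have := mulr_ge0 (c_min_ge0 p2) (powR_ge0 `|b y - (p - 1) / p * m y / W y| p).
  lra.
- exists y0 => // s sy0; have [_ _ Ws _ _] := H s sy0.
  rewrite /hardy_pot mulr_ge0_le0 ?powR_ge0// mulr_ge0_le0 ?powR_ge0//.
  by rewrite mulr_le0_ge0 ?powR_ge0// ltW.
- move=> e e0; have [r r0 rP] := hardy_pot_near p2 Dm0 DW0 m0 W0 e0.
  exists r => // s /andP[s1 s2].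
  have := rP s; rewrite ltr0_norm ?subr_lt0// => /(_ _).
  by rewrite ler_norml => /(_ _)/andP[]//; lra.
Qed.
End line.

(** Inversion is written as y |y|^-2, a product of measurable functions; at 0 both expressions are
    0. *)
Lemma measurable_funV d (T : measurableType d) (R : realType) (D : set T) (f : T -> R) :
  measurable_fun D f -> measurable_fun D (fun x => (f x)^-1).
Proof.
move=> mf; have -> : (fun x => (f x)^-1) = (fun y : R => y * `|y| `^ (- 2)) \o f.
  apply/funext => x /=; have [->|fx0] := eqVneq (f x) 0; first by rewrite invr0 mul0r.
  rewrite powRN powR_mulrn// real_normK ?num_real// expr2 invfM mulrA divff// mul1r//.
apply: measurableT_comp mf; apply: measurable_funM => //.
exact: measurableT_comp (@measurable_powR R _) (@normr_measurable R setT).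
Qed.

(** * The combined inequality on the half-line *)

Section rellich_hardy.
Context {R : realType}.
Notation mu := (@lebesgue_measure R).
Variables (p N : R) (h h1 h2 : R -> R) (a b : R).
Hypotheses (p2 : 2 <= p) (N0 : 0 < N) (a0 : 0 < a).
Hypothesis Dh : forall y : R, is_derive y 1 h (h1 y).
Hypothesis Dh1 : forall y : R, is_derive y 1 h1 (h2 y).
Hypothesis ch2 : continuous h2.
Hypothesis h_a : forall y, y < a -> h y = 0.
Hypothesis h_b : forall y, b < y -> h y = 0.

Let p0 : 0 < p. Proof. exact: lt_le_trans p2. Qed.
Let pn0 : p != 0. Proof. by rewrite gt_eqF. Qed.
Let k := (p - 1) / p.
Let ch y : {for y, continuous h} := is_derive1_continuous (Dh y).
Let ch1 y : {for y, continuous h1} := is_derive1_continuous (Dh1 y).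

Let h1_a y : y < a -> h1 y = 0.
Proof.
move=> ya; have D0 : is_derive y 1 h 0.
  apply: (@near_eq_is_derive _ _ _ (cst 0)).
  by near=> z; rewrite h_a//; near: z; exact: lt_nbhsl.
by rewrite -(@derive_val _ _ _ _ _ _ _ (Dh y)) (@derive_val _ _ _ _ _ _ _ D0).
Unshelve. all: by end_near. Qed.

Let h1_b y : b < y -> h1 y = 0.
Proof.
move=> ya; have D0 : is_derive y 1 h 0.
  apply: (@near_eq_is_derive _ _ _ (cst 0)).
  by near=> z; rewrite h_b//; near: z; exact: lt_nbhsr.
by rewrite -(@derive_val _ _ _ _ _ _ _ (Dh y)) (@derive_val _ _ _ _ _ _ _ D0).
Unshelve. all: by end_near. Qed.

(** The cross term is an exact derivative because [h2] is the derivative of [h1]; its potential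
    vanishes near 0 and far out, with [h]. *)
Let rellich_step :
  (\int[mu]_(y in `]0%R, +oo[) (`|N * h1 y| `^ p)%:E <=
   \int[mu]_(y in `]0%R, +oo[) (`|h2 y - N * h1 y| `^ p)%:E)%E.
Proof.
have cN y : {for y, continuous (fun y => N * h1 y)}.
  by apply: continuousM => //; exact: cst_continuous.
apply: (ge0_integral_le_halfline (G := fun y => - N^-1 * `|N * h1 y| `^ p)
  (dG := fun y => - (p * `|N * h1 y| `^ (p - 2) * (N * h1 y)) * h2 y)).
- move=> y y0; split.
  + by apply: continuous_abs_powR => //; apply: continuousB => //; exact: ch2.
  + exact: continuous_abs_powR.
  + have H := @is_derive1_comp _ (fun x => `|x| `^ p) (fun y => N * h1 y) y _ _
      (is_derive_abs_powR _ p2) (is_deriveZ N (Dh1 y)).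
    apply: (is_derive_cast (is_deriveZ (- N^-1) H)) => //.
    by rewrite /GRing.scale/=; field; rewrite gt_eqF.
  + exact: powR_ge0.
  + have := abs_powR_tangent (- (N * h1 y)) (h2 y) p2.
    rewrite normrN [- _ + _]addrC; apply: le_trans.
    by rewrite mulrN mulNr.
- by move=> y _; exact: powR_ge0.
- move=> e e0; exists a => // s; rewrite add0r => /andP[_ sa].
  by rewrite h1_a// mulr0 normr0 powR0// mulr0 ltW.
- by exists b => t bt; rewrite h1_b// mulr0 normr0 powR0// mulr0.
Qed.

(** The case W = id of [hardy_pointwise], this time keeping the term in c_p. *)
Let hardy_step :
  (\int[mu]_(y in `]0%R, +oo[)
     (`|k * h y / y| `^ p + c_min p * `|h1 y - k * h y / y| `^ p)%:E <=
   \int[mu]_(y in `]0%R, +oo[) (`|h1 y| `^ p)%:E)%E.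
Proof.
have ckh y : 0 < y -> {for y, continuous (fun y => k * h y / y)}.
  move=> y0; apply: continuousM.
    by apply: continuousM => //; exact: cst_continuous.
  by apply: continuousV; [rewrite gt_eqF|exact: cvg_id].
apply: (ge0_integral_le_halfline (G := hardy_pot p h id)
  (dG := fun y => hardy_dpot p (h y) (h1 y) y 1)).
- move=> y y0; have yn0 : y != 0 by rewrite gt_eqF.
  split.
  + exact: continuous_abs_powR.
  + apply: continuousD; first by apply: continuous_abs_powR => //; exact: ckh.
    apply: continuousM; first exact: cst_continuous.
    by apply: continuous_abs_powR => //; apply: continuousB => //; exact: ckh.
  + exact: (is_derive_hardy_pot p2 yn0 (Dh y) (is_derive_id y 1)).
  + by rewrite addr_ge0 ?mulr_ge0 ?powR_ge0 ?c_min_ge0.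
  + apply: (hardy_pointwise p2 yn0) => //.
    by rewrite subrr mulr0 subr0.
- by move=> y _; exact: powR_ge0.
- move=> e e0; exists a => // s; rewrite add0r => /andP[_ sa].
  by rewrite /hardy_pot h_a// normr0 powR0 ?gt_eqF// mul0r mulr0 ltW.
- exists b => t bt.
  by rewrite /hardy_pot h_b// normr0 powR0 ?gt_eqF// mul0r mulr0.
Qed.

Variable y0 : R.
Hypothesis y00 : 0 < y0.

Let m y := h y - h y0 * (y / y0) `^ k.
Let W y := y * ln (y / y0).

Let measurable_mW : measurable_fun [set: measurableTypeR R]
  (fun y => `|k * m y / W y| `^ p).
Proof.
have mh : measurable_fun [set: measurableTypeR R] h.
  by apply: continuous_measurable_fun; exact: ch.
have my : measurable_fun [set: measurableTypeR R] (fun y : measurableTypeR R => y / y0).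
  exact: mulrr_measurable.
apply: (measurableT_comp (@measurable_powR R p)).
apply: (measurableT_comp (@normr_measurable R setT)).
apply: measurable_funM; last first.
  apply: measurable_funV; apply: measurable_funM => //.
  exact: (measurableT_comp (@measurable_ln R) my).
apply: measurable_funM => //; apply: measurable_funB => //.
apply: measurable_funM => //; exact: (measurableT_comp (@measurable_powR R k) my).
Qed.

Let measurable_b : measurable_fun [set: measurableTypeR R]
  (fun y => `|h1 y - k * h y / y| `^ p).
Proof.
have mh : measurable_fun [set: measurableTypeR R] h.
  by apply: continuous_measurable_fun; exact: ch.
have mh1 : measurable_fun [set: measurableTypeR R] h1.
  by apply: continuous_measurable_fun; exact: ch1.
apply: (measurableT_comp (@measurable_powR R p)).
apply: (measurableT_comp (@normr_measurable R setT)).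
apply: measurable_funB => //; apply: measurable_funM; last first.
  by apply: measurable_funV.
by apply: measurable_funM.
Qed.

Let remainder_step :
  (\int[mu]_(y in `]0%R, +oo[) (`|k * m y / W y| `^ p)%:E <=
   \int[mu]_(y in `]0%R, +oo[) (`|h1 y - k * h y / y| `^ p)%:E)%E.
Proof.
have y0n0 : y0 != 0 by rewrite gt_eqF.
pose dm y := h1 y - h y0 * (k * (y / y0) `^ k / y).
pose dW y := ln (y / y0) + 1.
have Dq (y : R) : is_derive y 1 (fun y => y / y0) y0^-1.
  apply: (is_derive_cast (is_deriveZ y0^-1 (is_derive_id y 1))).
    by move=> z /=; rewrite mulrC.
  by rewrite /GRing.scale/= mulr1.
have Dm (y : R) : 0 < y -> is_derive y 1 m (dm y).
  move=> yp; have q0 : 0 < y / y0 by rewrite divr_gt0.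
  have H := @is_derive1_comp _ (fun x => x `^ k) (fun y => y / y0) y _ _
    (is_derive1_powR k q0) (Dq y).
  apply: (is_derive_cast (is_deriveB (Dh y) (is_deriveZ (h y0) H))) => //.
  rewrite /dm /GRing.scale/= powRB ?(gt_eqF q0) ?implybT// powRr1 ?ltW//.
  by field; rewrite y0n0 gt_eqF.
have DW (y : R) : 0 < y -> is_derive y 1 W (dW y).
  move=> yp; have q0 : 0 < y / y0 by rewrite divr_gt0.
  have H := @is_derive1_comp _ (@ln R) (fun y => y / y0) y _ _
    (is_derive1_ln q0) (Dq y).
  apply: (is_derive_cast (is_deriveM (is_derive_id y 1) H)) => //.
  by rewrite /dW /GRing.scale/=; field; rewrite y0n0 gt_eqF.
have cb (y : R) : 0 < y -> {for y, continuous (fun y => h1 y - k * h y / y)}.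
  move=> yp; apply: continuousB => //; apply: continuousM.
    by apply: continuousM => //; exact: cst_continuous.
  by apply: continuousV; [rewrite gt_eqF|exact: cvg_id].
(* As (W' - 1) / W = 1 / y, this is the invariance of m' - k m / y under adding to m a multiple of
   (y / y0)^k. *)
have E y : 0 < y -> W y * (h1 y - k * h y / y) =
    W y * dm y - (p - 1) / p * m y * (dW y - 1).
  by move=> yp; rewrite /dW /dm /W /m -/k; field; rewrite gt_eqF.
have m0 : m y0 = 0 by rewrite /m divff// powR1 mulr1 subrr.
have W0 : W y0 = 0 by rewrite /W divff// ln1 mulr0.
have DW0 : is_derive y0 1 W 1.
  by have := DW y0 y00; rewrite /dW divff// ln1 add0r.
have right : (\int[mu]_(y in `]y0, +oo[) (`|k * m y / W y| `^ p)%:E <=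
   \int[mu]_(y in `]y0, +oo[) (`|h1 y - k * h y / y| `^ p)%:E)%E.
  apply: (hardy_right p2 (dm := dm) (dW := dW) _ (Dm y0 y00) m0 DW0 W0).
  move=> y y0y; have yp := lt_trans y00 y0y.
  split; [exact: Dm|exact: DW| |exact: cb|exact: E].
  by rewrite /W mulr_gt0// ln_gt0// ltr_pdivlMr// mul1r.
have left : (\int[mu]_(y in `]0%R, y0[) (`|k * m y / W y| `^ p)%:E <=
   \int[mu]_(y in `]0%R, y0[) (`|h1 y - k * h y / y| `^ p)%:E)%E.
  apply: (hardy_left p2 y00 (dm := dm) (dW := dW) _ (Dm y0 y00) m0 DW0 W0).
  move=> y /andP[yp yy0].
  split; [exact: Dm|exact: DW| |exact: cb|exact: E].
  by rewrite /W pmulr_rlt0// ln_lt0// divr_gt0//= ltr_pdivrMr// mul1r.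
(* The singular point [y0] is a null set, so the two one-sided inequalities add up. *)
have split (f : R -> R) : measurable_fun [set: measurableTypeR R] f -> (forall y, 0 <= f y) ->
   (\int[mu]_(y in `]0%R, +oo[) (f y)%:E =
    \int[mu]_(y in `]0%R, y0[) (f y)%:E + \int[mu]_(y in `]y0, +oo[) (f y)%:E)%E.
  move=> /measurable_EFinP mf f0.
  rewrite (@itv_bndbnd_setU _ _ (BRight 0) (BLeft y0)) ?bnd_simp//.
  rewrite ge0_integral_setU//; last 3 first.
  - exact: measurable_funTS.
  - by move=> y _; rewrite lee_fin.
  - apply/disj_setPS => y [/=]; rewrite !in_itv/= andbT => /andP[_ +].
    by rewrite ltNge => /negP.
  congr (_ + _)%E; rewrite -integral_itv_obnd_cbnd//; exact: measurable_funTS.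
rewrite (split _ measurable_mW) => [|y]; last exact: powR_ge0.
rewrite (split _ measurable_b) => [|y]; last exact: powR_ge0.
exact: leeD.
Qed.

(** The integrals are kept apart so that [remainder_step] can act on the last one alone. *)
Let combined :
  ((N `^ p)%:E * (\int[mu]_(y in `]0%R, +oo[) (`|k * h y / y| `^ p)%:E +
    (c_min p)%:E * \int[mu]_(y in `]0%R, +oo[) (`|k * m y / W y| `^ p)%:E) <=
   \int[mu]_(y in `]0%R, +oo[) (`|h2 y - N * h1 y| `^ p)%:E)%E.
Proof.
have mh : measurable_fun [set: measurableTypeR R] h.
  by apply: continuous_measurable_fun; exact: ch.
have mh1 : measurable_fun [set: measurableTypeR R] h1.
  by apply: continuous_measurable_fun; exact: ch1.
have c0 := c_min_ge0 p2.
apply: le_trans rellich_step.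
under [leRHS]eq_integral do rewrite normrM powRM// gtr0_norm// EFinM.
rewrite ge0_integralZl//=; last 2 first.
- apply: measurable_funTS; apply/measurable_EFinP.
  apply: (measurableT_comp (@measurable_powR R p)).
  exact: (measurableT_comp (@normr_measurable R setT)).
- by rewrite lee_fin powR_ge0.
apply: lee_wpmul2l; first by rewrite lee_fin powR_ge0.
apply: le_trans hardy_step.
under [leRHS]eq_integral do rewrite EFinD EFinM.
rewrite ge0_integralD//=; last 3 first.
- apply: measurable_funTS; apply/measurable_EFinP.
  apply: (measurableT_comp (@measurable_powR R p)).
  apply: (measurableT_comp (@normr_measurable R setT)).
  by apply: measurable_funM; [exact: measurable_funM|exact: measurable_funV].
- by move=> y _; rewrite mule_ge0// lee_fin ?powR_ge0.
- apply: measurable_funTS; apply: emeasurable_funM => //.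
  exact/measurable_EFinP.
apply: leeD; first exact: lexx.
rewrite ge0_integralZl//=; last first.
  by apply: measurable_funTS; exact/measurable_EFinP.
by rewrite lee_wpmul2l.
Qed.
Lemma rellich_hardy_halfline :
  (\int[mu]_(y in `]0%R, +oo[) (N `^ p * (`|k * h y / y| `^ p +
     c_min p * `|k * m y / W y| `^ p))%:E <=
   \int[mu]_(y in `]0%R, +oo[) (`|h2 y - N * h1 y| `^ p)%:E)%E.
Proof.
have mh : measurable_fun [set: measurableTypeR R] h.
  by apply: continuous_measurable_fun; exact: ch.
have c0 := c_min_ge0 p2.
have m1 : measurable_fun (`]0, +oo[%classic : set (measurableTypeR R))
    (EFin \o (fun y => `|k * h y / y| `^ p)).
  apply: measurable_funTS; apply/measurable_EFinP.
  apply: (measurableT_comp (@measurable_powR R p)).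
  apply: (measurableT_comp (@normr_measurable R setT)).
  by apply: measurable_funM; [exact: measurable_funM|exact: measurable_funV].
have m2 : measurable_fun (`]0, +oo[%classic : set (measurableTypeR R))
    (EFin \o (fun y => `|k * m y / W y| `^ p)).
  by apply: measurable_funTS; exact/measurable_EFinP.
apply: le_trans combined.
under eq_integral do rewrite EFinM EFinD EFinM.
rewrite ge0_integralZl//=; first last.
- by rewrite lee_fin powR_ge0.
- by move=> y _; rewrite adde_ge0 ?mule_ge0 ?lee_fin ?powR_ge0.
- by apply: emeasurable_funD => //; exact: emeasurable_funM.
rewrite ge0_integralD//=; first last.
- exact: emeasurable_funM.
- by move=> y _; rewrite mule_ge0 ?lee_fin ?powR_ge0.
by rewrite ge0_integralZl.
Qed.
End rellich_hardy.

(** * Dilations and the gauge *)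

Section coordinates.
Context {R : realType} {n : nat}.
Notation V := ('rV[R]_n * R)%type.

Lemma is_diff_fst_coord (i : 'I_n) (z : V) :
  is_diff z (fun w : V => w.1 ord0 i) (fun v : V => v.1 ord0 i).
Proof.
have @f : {linear V -> R}.
  by exists (fun w : V => w.1 ord0 i); do 2![eexists]; do ?[constructor];
     rewrite ?mxE// => ? *; rewrite ?mxE//; move=> ?; rewrite !mxE.
have cf : continuous f.
  move=> w; apply: (@continuous_comp _ _ _ fst (fun x : 'rV[R]_n => x ord0 i)).
    exact: cvg_fst.
  exact: coord_continuous.
rewrite (_ : (fun _ => _) = f) //; apply: DiffDef; first exact: linear_differentiable.
by rewrite diff_lin.
Qed.

Lemma is_diff_snd (z : V) : is_diff z (fun w : V => w.2) (fun v : V => v.2).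
Proof.
have @f : {linear V -> R}.
  by exists (fun w : V => w.2); do 2![eexists]; do ?[constructor].
have cf : continuous f by move=> w; exact: cvg_snd.
rewrite (_ : (fun _ => _) = f) //; apply: DiffDef; first exact: linear_differentiable.
by rewrite diff_lin.
Qed.

Lemma is_derive_fst_coord (i : 'I_n) (z v : V) :
  is_derive z v (fun w : V => w.1 ord0 i) (v.1 ord0 i).
Proof.
have [d e] := is_diff_fst_coord i z.
by apply: DeriveDef; [exact: diff_derivable|rewrite deriveE// e].
Qed.

Lemma is_derive_snd (z v : V) : is_derive z v (fun w : V => w.2) v.2.
Proof.
have [d e] := is_diff_snd z.
by apply: DeriveDef; [exact: diff_derivable|rewrite deriveE// e].
Qed.

Lemma differentiable_fst_coord (i : 'I_n) (z : V) :
  differentiable (fun w : V => w.1 ord0 i) z.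
Proof. by have [] := is_diff_fst_coord i z. Qed.

Lemma differentiable_snd (z : V) : differentiable (fun w : V => w.2) z.
Proof. by have [] := is_diff_snd z. Qed.

(* The generator of the dilations, so that the derivative along it is
   [x . grad_x + 2 t d_t]. *)
Definition euler_dir (z : V) : V := (z.1, 2 * z.2).

Lemma euler_dirE (f : V -> R) (z : V) : differentiable f z ->
  \sum_(i < n) z.1 ord0 i * partial_x i f z + 2 * z.2 * partial_t f z =
  'D_(euler_dir z) f z.
Proof.
move=> df; rewrite deriveE//.
have -> : euler_dir z = \sum_(i < n) z.1 ord0 i *: ((delta_mx ord0 i, 0) : V) +
    (2 * z.2) *: ((0, 1) : V).
  rewrite /euler_dir [LHS]surjective_pairing [RHS]surjective_pairing /=.
  congr pair.
    rewrite scaler0 addr0 {1}[z.1]row_sum_delta; elim/big_ind2 : _ => //.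
    by move=> x1 x2 y1 y2 -> ->.
  rewrite [_ *: 1]mulr1 [X in X + _](_ : _ = 0) ?add0r//.
  by elim/big_ind : _ => //= [x y -> ->|i _]; rewrite ?addr0// scaler0.
rewrite linearD linear_sum linearZ/=; congr (_ + _).
  by apply: eq_bigr => i _; rewrite linearZ/= /partial_x deriveE.
by rewrite /partial_t deriveE.
Qed.

Lemma partial_rhoE (f : V -> R) (z : V) : differentiable f z ->
  partial_rho f z = (rho z)^-1 * 'D_(euler_dir z) f z.
Proof. by move=> df; rewrite /partial_rho euler_dirE. Qed.

Let is_derive1_diff (f : R -> R) (s df : R) : is_derive s 1 f df ->
  is_diff s f (fun h => h * df).
Proof.
move=> [d dE]; apply: DiffDef; first exact/derivable1_diffP.
apply/funext => h; rewrite -[h in LHS]mulr1 -[h * 1]/(h *: 1) linearZ/=.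
by rewrite -deriveE ?dE//; exact/derivable1_diffP.
Qed.

(** The velocity of the curve [dil s z] is [euler_dir] at the current point; the rest is the chain
    rule. *)
Lemma is_derive_dil (f : V -> R) (z : V) (s : R) : differentiable f (dil s z) ->
  is_derive s 1 (fun s => f (dil s z)) ('D_(euler_dir (dil s z)) f (dil s z)).
Proof.
move=> df.
have He := is_derive1_diff (is_derive_expR s).
have H1 : is_diff s (fun s => expR s *: z.1) (fun h => (h * expR s) *: z.1).
  exact: (is_diff_comp He (is_diff_scalel _ _)).
have D2 : is_derive s 1 (fun s => expR s ^+ 2 * z.2) (2 * expR s ^+ 2 * z.2).
  have H := is_deriveM (is_derive_expR s) (is_derive_expR s).
  apply: (is_derive_cast (is_deriveZ z.2 H)) => [r|].
    by rewrite expr2 [RHS]mulrC.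
  by rewrite /GRing.scale/=; ring.
have [d1 d2] := is_diff_pair H1 (is_derive1_diff D2).
have dfd : differentiable (f \o (fun s => dil s z)) s by exact: (differentiable_comp d1 df).
apply: DeriveDef; first exact/derivable1_diffP.
rewrite deriveE// deriveE// (diff_comp d1 df)/= d2 !mul1r; congr ('d f _ _).
by rewrite /euler_dir/= mulrA.
Qed.
End coordinates.

(** * The Euler operator of the dilations *)

Section euler.
Context {R : realType} {n : nat}.
Notation V := ('rV[R]_n * R)%type.
Implicit Types (f : V -> R) (z : V) (s : R).

(** This is rho d_rho, the derivative in ln rho along the orbits. *)
Definition euler f z := 'D_(euler_dir z) f z.

Lemma C1_differentiable f z : C_k 1 f -> differentiable f z.
Proof. by case. Qed.

Lemma C2_C1 f : C_k 2 f -> C_k 1 f.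
Proof.
move=> [df d2f]; split => // v; have [d _] := d2f v.
by move=> z; exact: differentiable_continuous.
Qed.

(** The direction [euler_dir z] moves with the point, whereas [C_k] speaks of fixed directions; the
    coordinate form separates the two. *)
Let euler_sum f : C_k 1 f -> euler f = \sum_(i < n)
  (fun z => z.1 ord0 i * partial_x i f z) + (fun z => 2 * z.2 * partial_t f z).
Proof.
move=> [df _]; apply/funext => z; rewrite /euler -euler_dirE//.
by rewrite [RHS]/= fct_sumE.
Qed.

Lemma continuous_euler f : C_k 1 f -> continuous (euler f).
Proof.
move=> Cf; rewrite euler_sum//; have [df cf] := Cf.
move=> z; apply: continuousD; last first.
  apply: continuousM; last exact: cf.
  apply: continuousM; first exact: cst_continuous.
  exact: differentiable_continuous (differentiable_snd z).
elim/big_ind : _ => [|g h cg ch|i _]; first exact: cst_continuous.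
- exact: continuousD.
- apply: continuousM; last exact: cf.
  exact: differentiable_continuous (differentiable_fst_coord i z).
Qed.

Lemma differentiable_euler f z : C_k 2 f -> differentiable (euler f) z.
Proof.
move=> Cf; rewrite euler_sum; last exact: C2_C1.
have [df d2f] := Cf.
apply: differentiableD.
  apply: differentiable_sum => i; apply: differentiableM.
    exact: differentiable_fst_coord.
  by have [] := d2f (delta_mx ord0 i, 0).
apply: differentiableM; last by have [] := d2f (0, 1).
by apply: differentiableM => //; exact: differentiable_snd.
Qed.

(** Differentiating the coordinate form leaves [euler] of first partials, to which
    [continuous_euler] applies, and the terms where the coefficients x_i and 2 t were
    differentiated. *)
Lemma continuous_euler2 f : C_k 2 f -> continuous (euler (euler f)).
Proof.
move=> Cf; have [df d2f] := Cf.
pose e (i : 'I_n) : V := (delta_mx ord0 i, 0).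
have E z : euler (euler f) z =
    \sum_(i < n) (z.1 ord0 i * euler ('D_(e i) f) z + z.1 ord0 i * 'D_(e i) f z) +
    2 * (z.2 * euler ('D_(0, 1) f) z + 2 * z.2 * 'D_(0, 1) f z).
  rewrite {1}/euler euler_sum; last exact: C2_C1.
  have dD v : is_derive z (euler_dir z) ('D_v f) (euler ('D_v f) z).
    by apply: DeriveDef => //; apply: diff_derivable; have [] := d2f v.
  have Hi i := is_deriveM (is_derive_fst_coord i z (euler_dir z)) (dD (e i)).
  have Ht := is_deriveM (is_deriveZ 2 (is_derive_snd z (euler_dir z))) (dD (0, 1)).
  have Hs := is_derive_sum Hi.
  rewrite -[X in X = _]/('D_(euler_dir z) (\sum_(i < n)
    ((fun w : V => w.1 ord0 i) * 'D_(e i) f) + ((2 \*: (fun w : V => w.2)) * 'D_(0, 1) f)) z).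
  have [_ ->] := is_deriveD Hs Ht.
  congr (_ + _).
    by apply: eq_bigr => i _; rewrite /GRing.scale/= [X in _ + X]mulrC.
  by rewrite /= /GRing.scale/=; ring.
rewrite (_ : euler _ = \sum_(i < n) (fun z => z.1 ord0 i * euler ('D_(e i) f) z + z.1 ord0 i * 'D_(e i) f z) +
   (fun z => 2 * (z.2 * euler ('D_(0, 1) f) z + 2 * z.2 * 'D_(0, 1) f z))); last first.
  by apply/funext => z; rewrite E [RHS]/= fct_sumE.
have cD v : continuous ('D_v f) by have [] := C2_C1 Cf; move=> _; exact.
have cED v : continuous (euler ('D_v f)) by apply: continuous_euler; exact: d2f.
have c2 z : {for z, continuous (fun w : V => w.2)}.
  exact: differentiable_continuous (differentiable_snd z).
move=> z; apply: continuousD; last first.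
  apply: continuousM; first exact: cst_continuous.
  apply: continuousD; apply: continuousM => //; first exact: cED.
    by apply: continuousM => //; exact: cst_continuous.
  exact: cD.
elim/big_ind : _ => [|g h cg ch|i _]; first exact: cst_continuous.
- exact: continuousD.
- have c1 := differentiable_continuous (differentiable_fst_coord i z).
  by apply: continuousD; apply: continuousM => //; [exact: cED|exact: cD].
Qed.
End euler.

(** * The gauge and the radial operator *)

Section rho.
Context {R : realType} {n : nat}.
Notation V := ('rV[R]_n * R)%type.
Implicit Types (f : V -> R) (z v : V) (s : R).

(** The fourth power of the gauge is a polynomial, hence smooth also at the origin, where the gauge
    is not. *)
Definition rho4 z : R := (\sum_(i < n) z.1 ord0 i ^+ 2) ^+ 2 + 4 * z.2 ^+ 2.

Lemma enorm_sqr (x : 'rV[R]_n) : enorm x ^+ 2 = \sum_(i < n) x ord0 i ^+ 2.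
Proof. by rewrite /enorm sqr_sqrtr// sumr_ge0// => i _; exact: sqr_ge0. Qed.

Lemma enorm_ge0 (x : 'rV[R]_n) : 0 <= enorm x. Proof. exact: sqrtr_ge0. Qed.

Lemma rho4E z : rho4 z = enorm z.1 ^+ 4 + 4 * z.2 ^+ 2.
Proof. by rewrite /rho4 -enorm_sqr -exprM. Qed.

Lemma rho4_ge0 z : 0 <= rho4 z.
Proof. by rewrite /rho4 addr_ge0 ?sqr_ge0// mulr_ge0 ?sqr_ge0. Qed.

Lemma rhoE z : rho z = rho4 z `^ 4^-1.
Proof. by rewrite /rho -rho4E. Qed.

Lemma rho_ge0 z : 0 <= rho z. Proof. exact: powR_ge0. Qed.

Lemma rho_exp4 z : rho z ^+ 4 = rho4 z.
Proof.
by rewrite rhoE -powR_mulrn ?powR_ge0// -powRrM mulVf ?powRr1 ?rho4_ge0.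
Qed.

Lemma rho4_gt0 z : z != 0 -> 0 < rho4 z.
Proof.
move=> z0; rewrite lt0r rho4_ge0 andbT; apply: contraNneq z0 => /eqP.
rewrite /rho4 paddr_eq0; [|exact: sqr_ge0|by rewrite mulr_ge0 ?sqr_ge0].
rewrite sqrf_eq0.
rewrite psumr_eq0 => [/andP[/allP x0]|i _]; last exact: sqr_ge0.
rewrite mulf_eq0 pnatr_eq0/= sqrf_eq0 => /eqP t0.
apply/eqP; rewrite [z]surjective_pairing t0; congr pair; apply/rowP => i.
by rewrite mxE; apply/eqP; have := x0 i (mem_index_enum _); rewrite sqrf_eq0.
Qed.

Lemma rho_gt0 z : z != 0 -> 0 < rho z.
Proof. by move=> z0; rewrite rhoE powR_gt0// rho4_gt0. Qed.

Lemma rho0 : rho (0 : V) = 0.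
Proof.
rewrite rhoE (_ : rho4 0 = 0) ?powR0 ?invr_eq0//.
by rewrite /rho4 big1 => [|i _]; rewrite ?mxE expr0n//= mulr0 addr0.
Qed.

Lemma enorm_dil s z : enorm (dil s z).1 = expR s * enorm z.1.
Proof.
apply: (@pexpIrn _ 2) => //; rewrite ?nnegrE ?mulr_ge0 ?enorm_ge0 ?expR_ge0//.
rewrite exprMn !enorm_sqr mulr_sumr; apply: eq_bigr => i _.
by rewrite mxE exprMn.
Qed.

Lemma rho_dil s z : rho (dil s z) = expR s * rho z.
Proof.
apply: (@pexpIrn _ 4) => //; rewrite ?nnegrE ?mulr_ge0 ?rho_ge0 ?expR_ge0//.
rewrite exprMn !rho_exp4 !rho4E enorm_dil /dil/=; ring.
Qed.

Lemma dil_neq0 s z : z != 0 -> dil s z != 0.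
Proof.
move=> z0; apply/negP => /eqP d0; have := rho_dil s z.
rewrite d0 rho0 => /esym/eqP; rewrite mulf_eq0 gt_eqF ?expR_gt0//=.
by rewrite gt_eqF// rho_gt0.
Qed.

Lemma differentiable_rho4 z : differentiable rho4 z.
Proof.
have e : rho4 = (\sum_(i < n) (fun w : V => w.1 ord0 i) ^+ 2) ^+ 2 +
    4 *: (fun w : V => w.2) ^+ 2.
  by apply/funext => w; rewrite /rho4 [RHS]/= fct_sumE.
rewrite e; apply: differentiableD.
  apply: differentiableX; apply: differentiable_sum => i.
  apply: differentiableX; exact: differentiable_fst_coord.
apply: differentiableZ; apply: differentiableX; exact: differentiable_snd.
Qed.

Lemma continuous_rho4 : continuous rho4.
Proof. by move=> z; apply: differentiable_continuous; exact: differentiable_rho4. Qed.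

Let derive_rho4 z v : 'D_v rho4 z =
  4 * enorm z.1 ^+ 2 * (\sum_(i < n) z.1 ord0 i * v.1 ord0 i) + 8 * z.2 * v.2.
Proof.
have Hi i := is_deriveX 2 (is_derive_fst_coord i z v).
have Hs := is_deriveX 2 (is_derive_sum Hi).
have Ht := is_deriveZ 4 (is_deriveX 2 (is_derive_snd z v)).
have e : rho4 = (\sum_(i < n) (fun w : V => w.1 ord0 i) ^+ 2) ^+ 2 +
    4 *: (fun w : V => w.2) ^+ 2.
  by apply/funext => w; rewrite /rho4 [RHS]/= fct_sumE.
rewrite e; have [_ ->] := is_deriveD Hs Ht.
rewrite /GRing.scale/= fct_sumE enorm_sqr !expr1; congr (_ + _); last by ring.
rewrite -!mulrA [X in 2 * (_ * X)](_ : _ = 2 * \sum_(i < n) z.1 ord0 i * v.1 ord0 i).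
  by ring.
by rewrite mulr_sumr; apply: eq_bigr => i _; rewrite expr1 mulrA.
Qed.

Lemma differentiable_rho z : z != 0 -> differentiable (@rho R n) z.
Proof.
move=> z0; have -> : @rho R n = (fun y => y `^ 4^-1) \o rho4.
  by apply/funext => w; rewrite rhoE.
apply: differentiable_comp; first exact: differentiable_rho4.
apply/derivable1_diffP; apply: derivable_powR.
by rewrite in_itv/= andbT rho4_gt0.
Qed.

(** Differentiates rho^4 = [rho4] and solves for the derivative of rho. *)
Let derive_rho z v : z != 0 -> 'D_v (@rho R n) z = (4 * rho z ^+ 3)^-1 * 'D_v rho4 z.
Proof.
move=> z0; have q0 := rho4_gt0 z0; have r0 := rho_gt0 z0.
have e : rho4 = (fun y => y ^+ 4) \o (@rho R n).
  by apply/funext => w /=; rewrite rho_exp4.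
have dr := differentiable_rho z0.
have dv : is_derive z v (@rho R n ^+ 4) ((4%:R * rho z ^+ 3) *: 'D_v (@rho R n) z).
  by apply: is_deriveX; apply: DeriveDef => //; exact: diff_derivable.
have -> : rho4 = @rho R n ^+ 4.
  by apply/funext => w; rewrite -rho_exp4.
have [_ ->] := dv.
by rewrite /GRing.scale/= mulKf// mulf_neq0// ?expf_neq0// gt_eqF.
Qed.

Lemma grad_norm_rho z : z != 0 -> grad_norm (@rho R n) z = enorm z.1 / rho z.
Proof.
move=> z0; have r0 := rho_gt0 z0.
have rn0 : rho z != 0 by rewrite gt_eqF.
rewrite /grad_norm -[RHS]ger0_norm; last by rewrite divr_ge0 ?enorm_ge0 ?ltW.
rewrite -sqrtr_sqr; congr Num.sqrt.
have px i : partial_x i (@rho R n) z = enorm z.1 ^+ 2 * z.1 ord0 i / rho z ^+ 3.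
  rewrite /partial_x derive_rho// derive_rho4/= mulr0 addr0.
  rewrite (bigD1 i)//= big1 => [|j ji]; last first.
    by rewrite mxE eqxx/= (negbTE ji) mulr0.
  by rewrite mxE !eqxx/= mulr1 addr0; field.
have pt : partial_t (@rho R n) z = 2 * z.2 / rho z ^+ 3.
  rewrite /partial_t derive_rho// derive_rho4/= big1 => [|j _]; last first.
    by rewrite mxE mulr0.
  by rewrite mulr0 add0r mulr1; field.
rewrite /grushin_grad/= pt enorm_sqr.
under eq_bigr do rewrite mxE px.
have -> : \sum_(i < n) (enorm z.1 ^+ 2 * z.1 ord0 i / rho z ^+ 3) ^+ 2 =
    enorm z.1 ^+ 4 / rho z ^+ 6 * enorm z.1 ^+ 2.
  by rewrite [in RHS]enorm_sqr mulr_sumr; apply: eq_bigr => i _; field.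
(* Both parts of the gradient carry a factor |x|^2, and what remains of the numerator is |x|^4 + 4
   t^2 = rho^4. *)
have -> : (enorm z.1 / rho z) ^+ 2 = enorm z.1 ^+ 2 * rho z ^+ 4 / rho z ^+ 6 by field.
by rewrite rho_exp4 rho4E; field.
Qed.

(** With E = [euler] and d_rho = rho^-1 E, moving E past rho^-1 gives d_rho^2 = rho^-2 (E^2 - E);
    adding (Q - 1) rho^-2 E leaves the coefficient Q - 2 = n. *)
Lemma radial_grushinE f z : (forall k, C_k k f) -> z != 0 ->
  radial_grushin f z =
  psi z / rho z ^+ 2 * (euler (euler f) z + n%:R * euler f z).
Proof.
move=> Cf z0; have r0 := rho_gt0 z0; have rn0 : rho z != 0 by rewrite gt_eqF.
have df w : differentiable f w := C1_differentiable w (Cf 1%N).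
have pE : partial_rho f = (fun w => (rho w)^-1 * euler f w).
  by apply/funext => w; rewrite partial_rhoE.
have dg : differentiable (partial_rho f) z.
  rewrite pE; apply: differentiableM; last exact: differentiable_euler (Cf 2%N).
  by apply: differentiableV => //; exact: differentiable_rho.
have d0 : dil 0 z = z by rewrite /dil expR0 scale1r expr1n mul1r -surjective_pairing.
have dg' : differentiable (partial_rho f) (dil 0 z) by rewrite d0.
have de' : differentiable (euler f) (dil 0 z).
  exact: differentiable_euler (Cf 2%N).
have D1 := is_derive_dil dg'.
(* The derivative of [D1] once more, now from [rho_dil] and the product rule; comparing the two
   values computes E of [partial_rho f]. *)
have D2 : is_derive (0 : R) 1 (fun s : R => partial_rho f (dil s z))
    ((rho z)^-1 * (euler (euler f) z - euler f z)).
  have H1 := is_derive_dil de'.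
  have H0 : is_derive (0 : R) 1 (fun s : R => expR (- s) : R) (-1 : R).
    have H := @is_derive1_comp _ (@expR R) -%R (0 : R) _ _ (is_derive_expR _) (is_deriveNid (0 : R) 1).
    by apply: (is_derive_cast H) => //; rewrite oppr0 expR0 mul1r.
  have H2 := is_deriveZ (rho z)^-1 (is_deriveM H0 H1).
  apply: (is_derive_cast H2).
    by move=> s; rewrite pE rho_dil invfM -expRN -mulrA [RHS]mulrCA.
  by rewrite /GRing.scale/= -/(euler (euler f) _) d0 oppr0 expR0; ring.
have E : 'D_(euler_dir z) (partial_rho f) z =
    (rho z)^-1 * (euler (euler f) z - euler f z).
  have := @derive_val _ _ _ _ _ _ _ D1.
  by rewrite (@derive_val _ _ _ _ _ _ _ D2) d0 => <-.
rewrite /radial_grushin partial_rhoE// E partial_rhoE// /hom_dim natrD -/(euler f z).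
by field.
Qed.

Lemma radial_grushin0 f : radial_grushin f 0 = 0.
Proof. by rewrite /radial_grushin /psi rho0 expr0n/= invr0 mulr0 mul0r. Qed.
End rho.

(** * Integration along dilation orbits *)

Section sphere.
Context {R : realType} {n : nat}.
Notation mu := (@lebesgue_measure R).
Notation X := ('rV[R]_n * measurableTypeR R)%type.

Lemma dil_dil (s r : R) (z : 'rV[R]_n * R) : dil s (dil r z) = dil (s + r) z.
Proof. by rewrite /dil/= expRD scalerA exprMn mulrA. Qed.

Lemma measurable_sqr_enorm : measurable_fun [set: X] (fun z : X => enorm z.1 ^+ 2).
Proof.
rewrite (_ : (fun z : X => _) = fun z : X => \sum_(i < n) z.1 ord0 i ^+ 2); last first.
  by apply/funext => z; rewrite enorm_sqr.
apply: measurable_sum => i; apply: measurable_funX.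
exact: (measurableT_comp (measurable_rV_coord i) measurable_fst).
Qed.

Lemma measurable_enorm : measurable_fun [set: X] (fun z : X => enorm z.1).
Proof.
rewrite (_ : (fun z : X => _) = (fun x => x `^ 2^-1) \o (fun z : X => enorm z.1 ^+ 2)).
  exact: (measurableT_comp (@measurable_powR R _) measurable_sqr_enorm).
by apply/funext => z /=; rewrite powR12_sqrt ?sqr_ge0// sqrtr_sqr ger0_norm ?enorm_ge0.
Qed.

Lemma measurable_rho : measurable_fun [set: X] (@rho R n : X -> R).
Proof.
rewrite (_ : @rho R n = (fun x => x `^ 4^-1) \o rho4); last first.
  by apply/funext => z /=; rewrite rhoE.
apply: (measurableT_comp (@measurable_powR R _)).
exact: (continuous_measurable_rVR (@continuous_rho4 R n)).
Qed.

Lemma measurable_gauge_ball (r : R) : measurable (gauge_ball r : set X).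
Proof.
rewrite (_ : gauge_ball r = @rho R n @^-1` `]-oo, r[%classic); last first.
  by apply/seteqP; split => z; rewrite /= in_itv.
by rewrite -[X in measurable X]setTI; apply: measurable_rho => //; exact: measurable_itv.
Qed.

Local Open Scope ereal_scope.

(** Every orbit off the origin meets rho = 1; moving the base point there shifts both line integrals
    by ln rho and multiplies them by the same positive factor. *)
Lemma ge0_le_integral_sphere (f g : X -> \bar R) :
  measurable_fun setT f -> measurable_fun setT g ->
  (forall z, 0 <= f z) -> (forall z, 0 <= g z) -> f 0%R = 0 ->
  (forall w : 'rV[R]_n * R, rho w = 1%R ->
    \int[mu]_y ((expR (- (hom_dim R n * y)))%:E * f (dil (- y) w)) <=
    \int[mu]_y ((expR (- (hom_dim R n * y)))%:E * g (dil (- y) w))) ->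
  \int[volume R n]_z f z <= \int[volume R n]_z g z.
Proof.
move=> mf mg f0 g0 f00 fg.
apply: (ge0_le_integral_orbits (L := (@ln R) \o (@rho R n))) => //.
- exact: (measurableT_comp (@measurable_ln R) measurable_rho).
- move=> z s z0; rewrite /= rho_dil lnM ?posrE ?expR_gt0 ?rho_gt0// expRK.
  by rewrite addrC.
move=> z z0; pose a := ln (rho z); pose w := dil (- a) z.
have w1 : rho w = 1%R.
  by rewrite rho_dil expRN lnK ?posrE ?rho_gt0// mulVf// gt_eqF// rho_gt0.
have shiftE (F : X -> \bar R) : measurable_fun setT F -> (forall z, 0 <= F z) ->
    \int[mu]_s ((expR (- (hom_dim R n * s)))%:E * F (dil (- s) z)) =
    (expR (- (hom_dim R n * a)))%:E *
    \int[mu]_y ((expR (- (hom_dim R n * y)))%:E * F (dil (- y) w)).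
  move=> mF F0.
  have mFd (x : 'rV[R]_n * R) : measurable_fun [set: measurableTypeR R]
      (fun s : R => (expR (- (hom_dim R n * s)))%:E * F (dil (- s) x)).
    apply: emeasurable_funM.
      apply/measurable_EFinP; apply: (measurableT_comp (@measurable_expR R)).
      by apply: measurable_funN; exact: mulrl_measurable.
    have mp : measurable_fun [set: measurableTypeR R]
        (fun s : measurableTypeR R => (x, (- s)%R) : X * measurableTypeR R).
      by apply: measurable_fun_pair => //; exact: oppr_measurable.
    have md : measurable_fun [set: measurableTypeR R] (fun s => dil (- s) x : X).
      exact: (measurableT_comp (@measurable_dil R n) mp).
    exact: (measurableT_comp mF md).
  have F0' x s : 0 <= (expR (- (hom_dim R n * s)))%:E * F (dil (- s) x).
    by rewrite mule_ge0// lee_fin expR_ge0.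
  have := ge0_integral_affine a (@ltr01 R) (mFd z) (F0' z).
  rewrite invr1 mul1e => <-.
  rewrite -ge0_integralZl//.
  apply: eq_integral => y _; rewrite mul1r muleA -EFinM -expRD.
  rewrite /w dil_dil; congr (_ * F (dil _ _)); last by rewrite opprD.
  by congr (expR _)%:E; rewrite mulrDr opprD addrC.
by rewrite !shiftE// lee_wpmul2l ?lee_fin ?expR_ge0// fg.
Qed.
End sphere.

(** * The three integrands *)

Section integrands.
Context {R : realType} {n : nat}.
Variables (p : R) (u : 'rV[R]_n * R -> R).
Hypotheses (p2 : 2 <= p) (u_test : test_function (gauge_ball 1 `\ 0) u).
Notation X := ('rV[R]_n * measurableTypeR R)%type.
Notation Q := (hom_dim R n).
Implicit Types (z w : 'rV[R]_n * R) (y r : R).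

Let k := (p - 1) / p.
Let p0 : 0 < p. Proof. exact: lt_le_trans p2. Qed.
Let pn0 : p != 0. Proof. by rewrite gt_eqF. Qed.
Let k0 : 0 < k. Proof. by rewrite divr_gt0// subr_gt0 (lt_le_trans _ p2)// ltr1n. Qed.

Let supp_sub z : u z != 0 -> z != 0 /\ rho z < 1.
Proof.
move=> uz; have [_ _ sub] := u_test.
have [z1 z0] : (gauge_ball 1 `\ 0) z by apply: sub; exact: subset_closure.
by split => //; apply/eqP.
Qed.

Lemma test_function0 : u 0 = 0.
Proof. by apply/eqP/negPn/negP => /supp_sub[]; rewrite eqxx. Qed.

(** Extreme values over the compact support, taken for the continuous [rho4] and carried over to
    [rho] by the monotone fourth root. They keep [u] away from both ends of every orbit. *)
Lemma test_function_supp : exists c d, [/\ 0 < c, 0 < d, d < 1 &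
  forall z, u z != 0 -> c <= rho z <= d].
Proof.
have [_ cK sub] := u_test; set K := closure _ in cK sub.
have [K0|/set0P K0] := eqVneq K set0.
  exists 2^-1, 2^-1; split; [lra|lra|lra|] => z uz.
  have : K z by apply: subset_closure. by rewrite K0.
have cr : {within K, continuous (@rho4 R n)}.
  exact: continuous_subspaceT (@continuous_rho4 R n).
have [a Ka amin] := compact_EVT_min K0 cK cr.
have [b Kb bmax] := compact_EVT_max K0 cK cr.
have /sub[a1 a0] : K a by move: Ka; rewrite ?inE.
have /sub[b1 b0] : K b by move: Kb; rewrite ?inE.
exists (rho a), (rho b); split => //.
- by rewrite rho_gt0//; apply/eqP.
- by rewrite rho_gt0//; apply/eqP.
move=> z uz; have zK : z \in K by rewrite inE; exact: subset_closure.
by rewrite !rhoE !ge0_ler_powR ?nnegrE ?rho4_ge0 ?amin ?bmax.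
Qed.

Lemma test_function_bounded : exists2 M, 0 < M & forall z, `|u z| <= M.
Proof.
have [Cu cK _] := u_test; set K := closure _ in cK.
have cu : continuous u by exact: (Cu 0%N).
have [K0|/set0P K0] := eqVneq K set0.
  exists 1 => // z; have [->|uz] := eqVneq (u z) 0; first by rewrite normr0.
  have : K z by apply: subset_closure. by rewrite K0.
have ca : {within K, continuous (fun z => `|u z|)}.
  apply: continuous_subspaceT => z; apply: continuous_comp; first exact: cu.
  exact: norm_continuous.
have [b Kb bmax] := compact_EVT_max K0 cK ca.
exists (`|u b| + 1); first by rewrite ltr_wpDl.
move=> z; have [->|uz] := eqVneq (u z) 0; first by rewrite normr0 addr_ge0.
have zK : z \in K by rewrite inE; exact: subset_closure.
by rewrite (le_trans (bmax z zK))// lerDl.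
Qed.

(* The integrands with enorm z.1 / rho z in place of grad_norm rho: the two
   agree off the origin, where u, hence each integrand, vanishes. *)
Definition rellich_int z : R :=
  `|radial_grushin u z| `^ p / ((enorm z.1 / rho z) `^ p * rho z `^ (Q - 2 * p)).

Definition hardy_int z : R :=
  `|u z| `^ p * (enorm z.1 / rho z) `^ p / (rho z `^ Q * ln (1 / rho z) `^ p).

Definition remainder_int r z : R :=
  `|u z - ln (1 / rho z) `^ k * r `^ k *
     u ((expR (- (1 / r)) / rho z) *: z.1,
        expR (- (2 / r)) * (z.2 / rho z ^+ 2))| `^ p /
  (rho z `^ Q * ln (1 / rho z) `^ p * `|ln (r * ln (1 / rho z))| `^ p) *
  (enorm z.1 / rho z) `^ p.

Lemma rellich_termE :
  rellich_term p u = (\int[volume R n]_(z in gauge_ball 1) (rellich_int z)%:E)%E.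
Proof.
apply: eq_integral => z _; congr EFin; rewrite /rellich_int.
have [->|z0] := eqVneq (z : 'rV[R]_n * R) 0; last by rewrite grad_norm_rho.
by rewrite radial_grushin0 normr0 (powR0 pn0) !mul0r.
Qed.

Lemma hardy_termE :
  hardy_term p u = (\int[volume R n]_(z in gauge_ball 1) (hardy_int z)%:E)%E.
Proof.
apply: eq_integral => z _; congr EFin; rewrite /hardy_int.
have [->|z0] := eqVneq (z : 'rV[R]_n * R) 0; last by rewrite grad_norm_rho.
by rewrite test_function0 normr0 (powR0 pn0) !mul0r.
Qed.

Lemma rellich_int_ge0 z : 0 <= rellich_int z.
Proof. by rewrite !(mulr_ge0, invr_ge0, powR_ge0). Qed.

Lemma hardy_int_ge0 z : 0 <= hardy_int z.
Proof. by rewrite !(mulr_ge0, invr_ge0, powR_ge0). Qed.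

Lemma remainder_int_ge0 r z : 0 <= remainder_int r z.
Proof. by rewrite !(mulr_ge0, invr_ge0, powR_ge0). Qed.

Lemma hardy_int0 : hardy_int 0 = 0.
Proof. by rewrite /hardy_int test_function0 normr0 (powR0 pn0) !mul0r. Qed.

(** By convention 1/0 = 0 and ln 0 = 0, so the logarithmic factor vanishes because k > 0, and
    [u 0 = 0] removes the rest. *)
Lemma remainder_int0 r : remainder_int r 0 = 0.
Proof.
rewrite /remainder_int rho0 mul1r invr0 ln0// (powR0 (lt0r_neq0 k0)) mul0r mul0r.
by rewrite test_function0 subr0 normr0 (powR0 pn0) !mul0r.
Qed.

Lemma d_CE r : (d_C p u r `^ p)%E =
  (\int[volume R n]_(z in gauge_ball 1) (remainder_int r z)%:E)%E.
Proof.
rewrite /d_C -poweRrM mulVf// poweRe1; last first.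
  apply: integral_ge0 => z _; rewrite lee_fin.
  by rewrite !(mulr_ge0, invr_ge0, powR_ge0).
apply: eq_integral => z _; congr EFin; rewrite /remainder_int.
have [->|z0] := eqVneq (z : 'rV[R]_n * R) 0; last by rewrite grad_norm_rho.
rewrite rho0 mul1r invr0 ln0// (powR0 (lt0r_neq0 k0)) mul0r mul0r.
by rewrite test_function0 subr0 normr0 (powR0 pn0) !mul0r.
Qed.

End integrands.

(** * The integrands along one orbit *)

Section orbits.
Context {R : realType} {n : nat}.
Variables (p : R) (u : 'rV[R]_n * R -> R).
Hypotheses (n0 : (0 < n)%N) (p2 : 2 <= p) (u_test : test_function (gauge_ball 1 `\ 0) u).
Notation X := ('rV[R]_n * measurableTypeR R)%type.
Notation Q := (hom_dim R n).
Implicit Types (z w : 'rV[R]_n * R) (y r : R).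

Let k := (p - 1) / p.
Let p0 : 0 < p. Proof. exact: lt_le_trans p2. Qed.
Let pn0 : p != 0. Proof. by rewrite gt_eqF. Qed.
Let k0 : 0 < k. Proof. by rewrite divr_gt0// subr_gt0 (lt_le_trans _ p2)// ltr1n. Qed.
Let Cu j : C_k j u. Proof. by have [] := u_test. Qed.

Let powRV (x a : R) : 0 <= x -> x^-1 `^ a = (x `^ a)^-1.
Proof. by move=> x0; rewrite -powR_inv1// powRAC powR_inv1// powR_ge0. Qed.

Let powR_expRN y a : expR (- y) `^ a = expR (- (a * y)).
Proof. by rewrite /powR gt_eqF ?expR_gt0// expRK mulrN. Qed.

Lemma rellich_constE : rellich_const n p = n%:R `^ p * k `^ p.
Proof.
rewrite /rellich_const /hom_dim natrD addrK -mulrA powRM//.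
exact: ltW.
Qed.

Section orbit.
Variable w : 'rV[R]_n * R.
Hypothesis w1 : rho w = 1.

Let P := enorm w.1.
Let P0 : 0 <= P. Proof. exact: enorm_ge0. Qed.

Let wn0 : w != 0.
Proof.
by apply/eqP => w0; move: w1; rewrite w0 rho0 => /eqP; rewrite eq_sym oner_eq0.
Qed.

Let h y := P * u (dil (- y) w).
(** Since y = - ln rho, a derivative in y is minus [euler]. *)
Let h1 y := - (P * euler u (dil (- y) w)).
Let h2 y := P * euler (euler u) (dil (- y) w).

Let rho_orbit y : rho (dil (- y) w) = expR (- y).
Proof. by rewrite rho_dil w1 mulr1. Qed.

Let gn_orbit y : enorm (dil (- y) w).1 / rho (dil (- y) w) = P.
Proof. by rewrite rho_orbit enorm_dil mulrAC mulfV ?mul1r// gt_eqF ?expR_gt0. Qed.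

(** On the orbit psi = P^2 and the operator brings a factor rho^-2; its p-th power, divided by P^p
    rho^(Q - 2p) and multiplied by rho^Q, keeps one factor P^p and no power of rho. *)
Lemma rellich_orbit y :
  expR (- (Q * y)) * rellich_int p u (dil (- y) w) = `|h2 y - n%:R * h1 y| `^ p.
Proof.
rewrite /rellich_int gn_orbit radial_grushinE ?dil_neq0// /psi rho_orbit.
rewrite enorm_dil -/P /h2 /h1.
set A := euler (euler u) _; set B := euler u _.
have E0 : 0 < expR (- y) by exact: expR_gt0.
have -> : P * A - n%:R * - (P * B) = P * (A + n%:R * B) by ring.
move: (A + _) => C.
have [P00|Pn0] := eqVneq P 0.
  by rewrite P00 !(mulr0, mul0r, expr0n)/= !(mul0r, normr0, powR0 pn0) mulr0.
have Pp : 0 < P by rewrite lt_neqAle eq_sym Pn0.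
have -> : (expR (- y) * P) ^+ 2 / expR (- y) ^+ 2 / expR (- y) ^+ 2 * C =
    P * (P * C) / expR (- y) ^+ 2.
  by field; rewrite gt_eqF.
rewrite normrM normfV normrM (gtr0_norm Pp) (gtr0_norm (exprn_gt0 2 E0)).
rewrite !powRM ?mulr_ge0 ?invr_ge0 ?exprn_ge0 ?(ltW E0)//.
rewrite powRV ?exprn_ge0 ?(ltW E0)// powRB ?(gt_eqF E0) ?implybT//.
rewrite powRrM powR_mulrn ?(ltW E0)// -powR_expRN.
by field; rewrite !gt_eqF ?powR_gt0 ?exprn_gt0.
Qed.

Lemma hardy_orbit y : 0 < y ->
  rellich_const n p * (expR (- (Q * y)) * hardy_int p u (dil (- y) w)) =
  n%:R `^ p * `|k * h y / y| `^ p.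
Proof.
move=> y0; rewrite /hardy_int gn_orbit rho_orbit mul1r -expRN opprK expRK.
rewrite rellich_constE -powR_expRN /h; move: k k0 => k' k'0.
rewrite !normrM normfV (gtr0_norm k'0) (gtr0_norm y0) (ger0_norm P0).
rewrite !powRM ?mulr_ge0 ?invr_ge0 ?(ltW k'0) ?(ltW y0)// powRV ?(ltW y0)//.
by field; rewrite !gt_eqF ?powR_gt0 ?expR_gt0.
Qed.

Lemma remainder_orbit r y : 0 < r -> 0 < y ->
  rellich_const n p * (expR (- (Q * y)) * remainder_int p u r (dil (- y) w)) =
  n%:R `^ p * `|k * (h y - h r^-1 * (y / r^-1) `^ k) / (y * ln (y / r^-1))| `^ p.
Proof.
move=> r0 y0; rewrite /remainder_int gn_orbit rho_orbit mul1r -/k.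
have -> : ln (expR (- y))^-1 = y by rewrite -expRN opprK expRK.
have E0 : 0 < expR (- y) by exact: expR_gt0.
(* The rescaled argument of [u] is the point of the same orbit with y = 1/r. *)
have -> : ((expR (- (1 / r)) / expR (- y)) *: (dil (- y) w).1,
        expR (- (2 / r)) * ((dil (- y) w).2 / expR (- y) ^+ 2)) = dil (- r^-1) w.
  rewrite /dil/= scalerA divfK ?gt_eqF// mul1r; congr pair.
  have -> : expR (- (2 / r)) = expR (- r^-1) ^+ 2.
    by rewrite -expRM_natl; congr expR; ring.
  by field; rewrite gt_eqF.
rewrite rellich_constE -powR_expRN /h invrK.
have -> : k * (P * u (dil (- y) w) - P * u (dil (- r^-1) w) * (y * r) `^ k) =
    k * P * (u (dil (- y) w) - y `^ k * r `^ k * u (dil (- r^-1) w)).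
  by rewrite powRM ?(ltW y0) ?(ltW r0)//; ring.
move: (u _ - _) => D; move: k k0 => k' k'0.
rewrite !normrM normfV !normrM (gtr0_norm k'0) (gtr0_norm y0) (ger0_norm P0).
rewrite !powRM ?mulr_ge0 ?invr_ge0 ?mulr_ge0 ?(ltW k'0) ?(ltW y0)//.
rewrite powRV ?mulr_ge0 ?(ltW y0)// powRM ?(ltW y0)// (mulrC r y).
(* At y = 1/r both sides are 0, since division by 0 yields 0. *)
have [l0|l0] := eqVneq (`|ln (y * r)| `^ p) 0.
  by rewrite l0 !(mulr0, invr0, mul0r).
by field; rewrite l0 !gt_eqF ?powR_gt0 ?expR_gt0.
Qed.

Lemma orbit_inequality r : 0 < r ->
  (\int[@lebesgue_measure R]_(y in `]0%R, +oo[)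
    ((rellich_const n p)%:E * ((expR (- (Q * y)))%:E *
      (hardy_int p u (dil (- y) w) + c_min p * remainder_int p u r (dil (- y) w))%:E)) <=
   \int[@lebesgue_measure R]_(y in `]0%R, +oo[)
    ((expR (- (Q * y)))%:E * (rellich_int p u (dil (- y) w))%:E))%E.
Proof.
move=> r0.
have [c [d [c0 d0 d1 cd]]] := test_function_supp u_test.
have dN (f : 'rV[R]_n * R -> R) y : (forall z, differentiable f z) ->
    is_derive y 1 (fun y => P * f (dil (- y) w)) (- (P * euler f (dil (- y) w))).
  move=> df.
  have H := @is_derive1_comp _ (fun s => f (dil s w)) -%R y _ _
    (is_derive_dil (df _)) (is_deriveNid y 1).
  apply: (is_derive_cast (is_deriveZ P H)) => //.
  by rewrite /GRing.scale/= mulrN1 mulrN.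
have Dh y : is_derive y 1 h (h1 y).
  by apply: dN => z; exact: C1_differentiable (Cu 1%N).
have Dh1 y : is_derive y 1 h1 (h2 y).
  have := is_deriveN (dN (euler u) y (fun z => differentiable_euler z (Cu 2%N))).
  by rewrite opprK; exact.
have ch2 : continuous h2.
  rewrite /h2 => y; apply: cvgM; first exact: cvg_cst.
  apply: (@continuous_comp _ _ _ (fun y => dil (- y) w) (euler (euler u))); last first.
    exact: (continuous_euler2 (Cu 2%N)).
  have ce : expR (- t) @[t --> y] --> expR (- y).
    apply: (@continuous_comp _ _ _ -%R (@expR R)); first exact: opp_continuous.
    exact: continuous_expR.
  have c1 : expR (- t) *: w.1 @[t --> y] --> expR (- y) *: w.1.
    by apply: cvgZ => //; exact: cvg_cst.
  have c2 : expR (- t) ^+ 2 * w.2 @[t --> y] --> expR (- y) ^+ 2 * w.2.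
    by apply: cvgM; [exact: cvgM|exact: cvg_cst].
  exact: (cvg_pair c1 c2).
(* The bounds c <= rho <= d on the support become - ln d <= y <= - ln c, and - ln d > 0 because d <
   1. *)
have h_a y : y < - ln d -> h y = 0.
  move=> yd; rewrite /h; have [->|uz] := eqVneq (u (dil (- y) w)) 0; first by rewrite mulr0.
  have /andP[_] := cd _ uz; rewrite rho_orbit.
  by rewrite -ler_ln ?posrE ?expR_gt0// expRK lerNl leNgt yd.
have h_b y : - ln c < y -> h y = 0.
  move=> yd; rewrite /h; have [->|uz] := eqVneq (u (dil (- y) w)) 0; first by rewrite mulr0.
  have /andP[+ _] := cd _ uz; rewrite rho_orbit.
  by rewrite -ler_ln ?posrE ?expR_gt0// expRK lerNr leNgt yd.
have a0 : 0 < - ln d by rewrite oppr_gt0 ln_lt0// d0.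
have N0 : 0 < n%:R :> R by rewrite ltr0n.
have ir0 : 0 < r^-1 by rewrite invr_gt0.
have H := rellich_hardy_halfline p2 N0 a0 Dh Dh1 ch2 h_a h_b ir0.
apply: (@le_trans _ _ (\int[lebesgue_measure]_(y in `]0%R, +oo[)
    (`|h2 y - n%:R * h1 y| `^ p)%:E)%E); last first.
  rewrite le_eqVlt; apply/orP; left; apply/eqP; apply: eq_integral => y _.
  by rewrite -EFinM rellich_orbit.
apply: le_trans H.
rewrite le_eqVlt; apply/orP; left; apply/eqP; apply: eq_integral => y.
rewrite inE/= in_itv/= andbT => y0.
rewrite -!EFinM; congr EFin; rewrite mulrDr mulrDr hardy_orbit// mulrDr.
by congr (_ + _); rewrite (mulrCA _ (c_min p)) (mulrCA _ (c_min p)) remainder_orbit// mulrCA.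
Qed.
End orbit.
End orbits.

Section measurability.
Context {R : realType} {n : nat}.
Variables (p : R) (u : 'rV[R]_n * R -> R).
Hypothesis u_test : test_function (gauge_ball 1 `\ 0) u.
Notation X := ('rV[R]_n * measurableTypeR R)%type.
Notation Q := (hom_dim R n).

Let Cu j : C_k j u. Proof. by have [] := u_test. Qed.

Let mu_ : measurable_fun [set: X] (u : X -> R).
Proof. exact: (continuous_measurable_rVR (Cu 0)). Qed.

Let m_powR (f : X -> R) a : measurable_fun [set: X] f ->
  measurable_fun [set: X] (fun z => f z `^ a).
Proof. by move=> mf; apply: (measurableT_comp (@measurable_powR R a)). Qed.

Let m_norm (f : X -> R) : measurable_fun [set: X] f ->
  measurable_fun [set: X] (fun z => `|f z|).
Proof. by move=> mf; apply: (measurableT_comp (@normr_measurable R setT)). Qed.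

Let m_gn : measurable_fun [set: X] (fun z : X => enorm z.1 / rho z).
Proof.
apply: measurable_funM; first exact: measurable_enorm.
by apply: measurable_funV; exact: measurable_rho.
Qed.

Let m_ln : measurable_fun [set: X] (fun z : X => ln (1 / rho z)).
Proof.
apply: (measurableT_comp (@measurable_ln R)); apply: measurable_funM => //.
by apply: measurable_funV; exact: measurable_rho.
Qed.

Lemma measurable_rellich_int : measurable_fun [set: X] (rellich_int p u : X -> R).
Proof.
have rE (z : 'rV[R]_n * R) : radial_grushin u z = enorm z.1 ^+ 2 / rho z ^+ 2 / rho z ^+ 2 *
    (euler (euler u) z + n%:R * euler u z).
  have [->|z0] := eqVneq z 0; last by rewrite radial_grushinE.
  by rewrite radial_grushin0 rho0 expr0n/= invr0 !(mulr0, mul0r).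
apply: measurable_funM.
  apply: m_powR; apply: m_norm; rewrite (funext rE).
  apply: measurable_funM.
    by do 2?[apply: measurable_funM; last (apply: measurable_funV;
      apply: measurable_funX; exact: measurable_rho)]; exact: measurable_sqr_enorm.
  apply: measurable_funD.
    exact: (continuous_measurable_rVR (continuous_euler2 (Cu 2))).
  apply: measurable_funM => //.
  exact: (continuous_measurable_rVR (continuous_euler (Cu 1))).
apply: measurable_funV; apply: measurable_funM; first exact: m_powR.
apply: m_powR; exact: measurable_rho.
Qed.

Lemma measurable_hardy_int : measurable_fun [set: X] (hardy_int p u : X -> R).
Proof.
apply: measurable_funM.
  by apply: measurable_funM; apply: m_powR => //; exact: m_norm.
apply: measurable_funV; apply: measurable_funM; last exact: m_powR.
apply: m_powR; exact: measurable_rho.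
Qed.

Lemma measurable_remainder_int r :
  measurable_fun [set: X] (remainder_int p u r : X -> R).
Proof.
have mrho := @measurable_rho R n.
apply: measurable_funM; last exact: m_powR.
apply: measurable_funM; last first.
  apply: measurable_funV; apply: measurable_funM.
    by apply: measurable_funM; apply: m_powR.
  apply: m_powR; apply: m_norm; apply: (measurableT_comp (@measurable_ln R)).
  exact: measurable_funM.
apply: m_powR; apply: m_norm; apply: measurable_funB => //.
apply: measurable_funM.
  by apply: measurable_funM => //; exact: m_powR.
have mphi : measurable_fun [set: X] (fun z : X =>
   ((expR (- (1 / r)) / rho z) *: z.1, expR (- (2 / r)) * (z.2 / rho z ^+ 2)) : X).
  apply: measurable_fun_pair => /=.
    apply: measurable_fun_rV => i; rewrite /rV_coord.
    under eq_fun do rewrite mxE.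
    apply: measurable_funM.
      by apply: measurable_funM => //; exact: measurable_funV.
    exact: (measurableT_comp (measurable_rV_coord i) measurable_fst).
  apply: measurable_funM => //; apply: measurable_funM; first exact: measurable_snd.
  by apply: measurable_funV; exact: measurable_funX.
exact: (measurableT_comp mu_ mphi).
Qed.
End measurability.

(** * Integration over the ball *)

Section inequality.
Context {R : realType} {n : nat}.
Variables (p : R) (u : 'rV[R]_n * R -> R).
Hypotheses (n0 : (0 < n)%N) (p2 : 2 <= p) (u_test : test_function (gauge_ball 1 `\ 0) u).
Notation X := ('rV[R]_n * measurableTypeR R)%type.
Notation Q := (hom_dim R n).
Local Open Scope ereal_scope.

Let p0 : (0 < p)%R. Proof. exact: lt_le_trans p2. Qed.

(** Makes the subtraction in the theorem legitimate: on the support rho stays away from 0 and 1, so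
    the integrand is bounded, and the ball has finite volume. *)
Lemma hardy_term_lty : hardy_term p u < +oo.
Proof.
rewrite (hardy_termE p2 u_test).
have [c [d [c0 d0 d1 cd]]] := test_function_supp u_test.
have [M M0 uM] := test_function_bounded u_test.
have ld0 : (0 < ln (1 / d))%R by rewrite ln_gt0// ltr_pdivlMr// mul1r.
(* Bounds |u| by M, |x| / rho by 1, rho from below by c and the logarithm from below by its value at
   d. *)
pose B := (M `^ p / (c `^ Q * ln (1 / d) `^ p))%R.
have B0 : (0 <= B)%R by rewrite !(mulr_ge0, invr_ge0, powR_ge0).
have hB (z : 'rV[R]_n * R) : (hardy_int p u z <= B)%R.
  have [uz|uz] := eqVneq (u z) 0%R.
    by rewrite /hardy_int uz normr0 powR0 ?gt_eqF// !mul0r.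
  have /andP[cz zd] := cd z uz; have z0 : (0 < rho z)%R by exact: lt_le_trans cz.
  rewrite /hardy_int ler_pM//.
  - by rewrite mulr_ge0 ?powR_ge0.
  - by rewrite invr_ge0 mulr_ge0 ?powR_ge0.
  - rewrite -[leRHS]mulr1 ler_pM ?powR_ge0//.
      by rewrite ge0_ler_powR ?nnegrE ?(ltW M0) ?(ltW p0).
    have : ((enorm z.1 / rho z) `^ p <= 1 `^ p)%R; last by rewrite powR1.
    rewrite ge0_ler_powR ?nnegrE ?divr_ge0 ?enorm_ge0 ?(ltW z0) ?(ltW p0)//.
    rewrite ler_pdivrMr// mul1r -(@ler_pXn2r _ 4) ?nnegrE ?enorm_ge0 ?(ltW z0)//.
    by rewrite rho_exp4 rho4E lerDl mulr_ge0// sqr_ge0.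
  - have lr0 : (0 < ln (1 / rho z))%R.
      by rewrite ln_gt0// ltr_pdivlMr// mul1r (le_lt_trans zd).
    have q0 := mulr_gt0 (powR_gt0 Q z0) (powR_gt0 p lr0).
    have q1 := mulr_gt0 (powR_gt0 Q c0) (powR_gt0 p ld0).
    rewrite lef_pV2 ?posrE//; apply: ler_pM; rewrite ?powR_ge0//.
      by rewrite ge0_ler_powR ?nnegrE ?(ltW c0) ?(ltW z0)//.
    rewrite ge0_ler_powR ?nnegrE ?(ltW p0) ?(ltW ld0)//.
      by rewrite ln_ge0// ler_pdivlMr// mul1r (le_trans zd)// ltW.
    by rewrite ler_ln ?posrE ?divr_gt0// !mul1r lef_pV2 ?posrE.
have ball_box : (gauge_ball 1 : set X) `<=` @box R n 1.
  move=> z /= z1; have q1 : (rho4 z < 1)%R.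
    by rewrite -rho_exp4 exprn_ilt1// rho_ge0.
  have S0 : (0 <= \sum_(i < n) z.1 ord0 i ^+ 2)%R by rewrite sumr_ge0// => i _; exact: sqr_ge0.
  have T0 := sqr_ge0 z.2; rewrite /rho4 in q1.
  split => [i|]; rewrite /= in_itv/= -ler_norml -(@ler_pXn2r _ 2) ?nnegrE// expr1n real_normK ?num_real//.
    apply: (@le_trans _ _ (\sum_(i < n) z.1 ord0 i ^+ 2)%R).
      by rewrite (bigD1 i)//= lerDl sumr_ge0// => j _; exact: sqr_ge0.
    by rewrite -(@ler_pXn2r _ 2) ?nnegrE// expr1n; nra.
  by have := sqr_ge0 (\sum_(i < n) z.1 ord0 i ^+ 2)%R; nra.
have mB := measurable_gauge_ball (1 : R) : measurable (gauge_ball 1 : set X).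
apply: (@le_lt_trans _ _ (\int[volume R n]_(z in gauge_ball 1) (cst B%:E z))).
  apply: ge0_le_integral => //.
  - by move=> z _; rewrite lee_fin hardy_int_ge0.
  - by apply: measurable_funTS; apply/measurable_EFinP; exact: measurable_hardy_int.
  - by move=> z _; rewrite lee_fin.
rewrite integral_cst//; apply: lte_mul_pinfty => //.
apply: le_lt_trans (volume_box_lty R n 1); apply: le_measure => //; rewrite inE//.
exact: measurable_box.
Qed.

(** The two terms on the left are merged into the integral of a single [f], to which the orbit
    comparison applies. *)
Lemma rellich_hardy_remainder r : (0 < r)%R ->
  (rellich_const n p)%:E * hardy_term p u +
  (c_min p * rellich_const n p)%:E * d_C p u r `^ p <= rellich_term p u.
Proof.
move=> r0; have C0 : (0 <= rellich_const n p)%R by exact: powR_ge0.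
have c0 := c_min_ge0 p2.
rewrite (hardy_termE p2 u_test) (rellich_termE u p2) (d_CE p2 u_test).
have mB := measurable_gauge_ball (1 : R) : measurable (gauge_ball 1 : set X).
have mh : measurable_fun [set: X] (EFin \o hardy_int p u).
  by apply/measurable_EFinP; exact: measurable_hardy_int.
have md : measurable_fun [set: X] (EFin \o remainder_int p u r).
  by apply/measurable_EFinP; exact: measurable_remainder_int.
have mr : measurable_fun [set: X] (EFin \o rellich_int p u).
  by apply/measurable_EFinP; exact: measurable_rellich_int.
pose f (z : X) := (rellich_const n p)%:E *
  (hardy_int p u z + c_min p * remainder_int p u r z)%:E.
have f0 z : 0 <= f z.
  by rewrite mule_ge0 ?lee_fin// addr_ge0 ?hardy_int_ge0// mulr_ge0// remainder_int_ge0.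
have mf : measurable_fun [set: X] f.
  apply: emeasurable_funM => //; apply/measurable_EFinP.
  apply: measurable_funD; first exact: measurable_hardy_int.
  by apply: measurable_funM => //; exact: measurable_remainder_int.
have -> : (rellich_const n p)%:E * \int[volume R n]_(z in gauge_ball 1) (hardy_int p u z)%:E +
    (c_min p * rellich_const n p)%:E *
      \int[volume R n]_(z in gauge_ball 1) (remainder_int p u r z)%:E =
    \int[volume R n]_(z in gauge_ball 1) f z.
  have h0 z : 0 <= (hardy_int p u z)%:E by rewrite lee_fin hardy_int_ge0.
  have d0 z : 0 <= (c_min p)%:E * (remainder_int p u r z)%:E.
    by rewrite mule_ge0 ?lee_fin ?remainder_int_ge0.
  have mcd : measurable_fun [set: X] (fun z => (c_min p)%:E * (remainder_int p u r z)%:E).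
    exact: emeasurable_funM.
  transitivity (\int[volume R n]_(z in gauge_ball 1) ((rellich_const n p)%:E *
      ((hardy_int p u z)%:E + (c_min p)%:E * (remainder_int p u r z)%:E))); last first.
    by apply: eq_integral => z _; rewrite /f EFinD EFinM.
  rewrite ge0_integralZl//; first last.
  - by move=> z _; rewrite adde_ge0.
  - by apply: measurable_funTS; exact: emeasurable_funD.
  rewrite ge0_integralD//; first last.
  - exact: measurable_funTS.
  - exact: measurable_funTS.
  rewrite ge0_integralZl//; first last.
  - by move=> z _; rewrite lee_fin remainder_int_ge0.
  - exact: measurable_funTS.
  have I1 : 0 <= \int[volume R n]_(z in gauge_ball 1) (hardy_int p u z)%:E.
    exact: integral_ge0.
  have I2 : 0 <= \int[volume R n]_(z in gauge_ball 1) (remainder_int p u r z)%:E.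
    by apply: integral_ge0 => z _; rewrite lee_fin remainder_int_ge0.
  have distr (a b : R) (x y : \bar R) : (0 <= b)%R -> 0 <= x -> 0 <= y ->
      a%:E * x + (b * a)%:E * y = a%:E * (x + b%:E * y).
    move=> b0 x0 y0; rewrite ge0_muleDr ?mule_ge0 ?lee_fin//.
    by rewrite muleA -EFinM [(b * a)%R]mulrC.
  exact: distr.
rewrite integral_mkcond [leRHS]integral_mkcond.
apply: ge0_le_integral_sphere.
- by apply/(measurable_restrictT _ mB); exact: measurable_funTS.
- by apply/(measurable_restrictT _ mB); exact: measurable_funTS.
- by move=> z; apply: erestrict_ge0.
- by move=> z; apply: erestrict_ge0 => x _; rewrite lee_fin rellich_int_ge0.
- rewrite patchE; case: ifP => // _.
  by rewrite /f (hardy_int0 p2 u_test) (remainder_int0 p2 u_test) mulr0 addr0 mule0.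
move=> w w1.
(* As rho = e^(-y) on the orbit of [w], the unit ball cuts out y > 0. *)
have restrictE (F : X -> \bar R) :
    \int[lebesgue_measure]_y ((expR (- (Q * y)))%:E * (F \_ (gauge_ball 1)) (dil (- y) w)) =
    \int[lebesgue_measure]_(y in `]0%R, +oo[)
      ((expR (- (Q * y)))%:E * F (dil (- y) w)).
  rewrite [RHS]integral_mkcond; apply: eq_integral => y _; rewrite !patchE.
  have -> : (dil (- y) w \in (gauge_ball 1 : set X)) = (y \in (`]0%R, +oo[%classic : set R)).
    apply/idP/idP; rewrite !inE /= /gauge_ball/= rho_dil w1 mulr1 in_itv/= andbT.
      by rewrite expR_lt1 oppr_lt0.
    by rewrite expR_lt1 oppr_lt0.
  by case: ifP => // _; rewrite mule0.
rewrite !restrictE; apply: le_trans (orbit_inequality n0 p2 u_test w1 r0).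
by rewrite le_eqVlt; apply/orP; left; apply/eqP; apply: eq_integral => y _; rewrite muleCA.
Qed.

End inequality.

Theorem theorem6p2 (R : realType) (n : nat) (p : R) (u : 'rV[R]_n * R -> R)
    (n_ge1 : (1 <= n)%N) (p_ge2 : 2 <= p) (p_ltQ : p < hom_dim R n)
    (u_test : test_function (gauge_ball 1 `\ 0) u) :
  ((rellich_term p u - (rellich_const n p)%:E * hardy_term p u) >=
   (c_min p * rellich_const n p)%:E *
   ereal_sup [set d_C p u r `^ p | r in [set r : R | (0 < r)%R]])%E.
Proof.
have C0 : 0 <= rellich_const n p by exact: powR_ge0.
have a0 : 0 <= c_min p * rellich_const n p by rewrite mulr_ge0// c_min_ge0.
have hfin : hardy_term p u \is a fin_num.
  rewrite ge0_fin_numE ?(hardy_term_lty p_ge2 u_test)//.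
  rewrite (hardy_termE p_ge2 u_test); apply: integral_ge0 => z _.
  by rewrite lee_fin hardy_int_ge0.
set T := (rellich_term p u - _)%E.
have dT r : 0 < r -> ((c_min p * rellich_const n p)%:E * d_C p u r `^ p <= T)%E.
  move=> r0; rewrite leeBrDl ?fin_numM//.
  exact: (rellich_hardy_remainder n_ge1 p_ge2 u_test).
(* If the constant is 0, the left side is 0 whatever the supremum, as 0 times +oo is 0, and r = 1
   shows that [T] is nonnegative. Otherwise division by the constant allows the supremum to be
   bounded term by term. *)
move: a0; rewrite le_eqVlt => /predU1P[a0|a0].
  by have := dT 1 ltr01; rewrite -a0 !mul0e.
rewrite -lee_pdivlMl//; apply: ge_ereal_sup => _ [r /= r0 <-].
by rewrite lee_pdivlMl// dT.
Qed.
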